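(* Assume that the domain $\Omega\subset\mathbb R^d$ has finite measure. Then the form $a_C$ given by $a_C(\psi,\psi')=(M_C^d\nabla\psi\mid\nabla\psi')_{H^d}$ is continuous as a mapping $a_C:V\times V\to\mathbb C$ if and only if the operator family $C=\{C(x):x\in\Omega\}$ is essentially uniformly bounded, i.e. there is $M\ge 0$ with $\|C(x)\|_{\mathcal L(\ell^2(\mathbb N))}\le M$ for almost all $x\in\Omega$.
   Context: $\Omega\subset\mathbb R^d$ is a domain and $C:\Omega\to\mathcal L(\ell^2(\mathbb N))$, $C(x)=(c_{ij}(x))_{i,j\in\mathbb N}$, is componentwise measurable. $H:=\bigoplus_{i\in\mathbb N}L^2(\Omega)$ and $V:=\bigoplus_{i\in\mathbb N}H^1(\Omega)$ are Hilbert space direct sums (square-summable sequences $\psi=(\psi_i)_{i\in\mathbb N}$ with scalar product $\sum_i(\psi_i\mid\psi_i')$). $M_C$ is the multiplication operator $(M_C\psi)_n(x):=\sum_{m\in\mathbb N}c_{nm}(x)\psi_m(x)$ on $H$ with maximal domain, and $M_C^d$ acts on $H^d$ by $M_C^d(\psi^1,\dots,\psi^d)=(M_C\psi^1,\dots,M_C\psi^d)$. For $\psi\in V$, $\nabla\psi:=(\nabla\psi_n)_{n\in\mathbb N}\in H^d$; the scalar product of $H^d$ is $(\psi\mid\psi')_{H^d}=\sum_{k=1}^d\sum_{i}(\psi_i^k\mid\psi_i'^k)_{L^2(\Omega)}$. The form $a_C$ is defined a priori on finite sequences in $V$. A sesquilinear form $a:V\times V\to\mathbb C$ is continuous if $|a(\psi,\psi')|\le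 M\|\psi\|_V\|\psi'\|_V$ for some $M$ and all $\psi,\psi'\in V$. *)

(* Defs.v *)
From HB Require Import structures.
From mathcomp Require Import all_boot all_order all_algebra.
From mathcomp Require Import complex.
From mathcomp Require Import all_classical all_reals all_analysis.

Set Implicit Arguments.
Unset Strict Implicit.
Unset Printing Implicit Defensive.

Import Order.TTheory GRing.Theory Num.Theory.
Import numFieldNormedType.Exports.
Import ComplexField.Normc.

Local Open Scope classical_set_scope.
Local Open Scope ring_scope.

(* The sigma-algebra generated by the coordinates, i.e. the Borel one. *)
Definition rV_display : measure_display.
Proof. exact: default_measure_display. Qed.

Section measurable_rV.
Context (R : realType) (n : nat).

Let coors : 'I_n -> 'rV[R]_n -> R := fun i x => x 0 i.

Let rV_set0 : g_sigma_preimage coors set0.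
Proof. exact: sigma_algebra0. Qed.

Let rV_setC A : g_sigma_preimage coors A -> g_sigma_preimage coors (~` A).
Proof. exact: sigma_algebraC. Qed.

Let rV_bigcup (F : (set 'rV[R]_n)^nat) : (forall i, g_sigma_preimage coors (F i)) ->
  g_sigma_preimage coors (\bigcup_i (F i)).
Proof. exact: sigma_algebra_bigcup. Qed.

HB.instance Definition _ := @isMeasurable.Build rV_display
  'rV[R]_n (g_sigma_preimage coors) rV_set0 rV_setC rV_bigcup.

Lemma measurable_rV_coord (i : 'I_n) :
  measurable_fun [set: 'rV[R]_n] (fun x : 'rV[R]_n => x 0 i).
Proof.
move=> _ Y mY; rewrite setTI; apply: sub_sigma_algebra => /=.
rewrite -bigcup_seq/=; exists i => /=; first by rewrite mem_index_enum.
by exists Y => //; rewrite setTI.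
Qed.

Lemma measurable_fun_rVP d (T : measurableType d) (f : T -> 'rV[R]_n) :
  measurable_fun [set: T] f <->
  forall i, measurable_fun [set: T] (fun x => f x 0 i).
Proof.
apply: (@iff_trans _ (g_sigma_preimage (fun i => coors i \o f) `<=` measurable)).
  rewrite g_sigma_preimage_comp; split=> [mf A [/= C preC <-]|prefS].
    exact: mf.
  by move=> _ A mA; apply: prefS; exists A.
split=> [fS i|mf].
- move=> _ A mA; apply: fS; apply: sub_sigma_algebra.
  rewrite -bigcup_seq/=; exists i => /=; first by rewrite mem_index_enum.
  by exists A.
- apply: smallest_sub; first exact: sigma_algebra_measurable.
  rewrite -bigcup_seq/=; apply: bigcup_sub => i _.
  by move=> A [B mB <-]; exact: mf.
Qed.

End measurable_rV.

Lemma product_measure1_sigma_finite d1 d2 (T1 : measurableType d1)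
    (T2 : measurableType d2) (R : realType)
    (m1 : {sigma_finite_measure set T1 -> \bar R})
    (m2 : {sigma_finite_measure set T2 -> \bar R}) :
  sigma_finite setT (m1 \x m2)%E.
Proof.
have /sigma_finiteP[F [TF ndF Foo]] := sigma_finiteT m1.
have /sigma_finiteP[G [TG ndG Goo]] := sigma_finiteT m2.
exists (fun n => F n `*` G n).
  rewrite -setXTT TF TG predeqE => -[x y]; split.
    move=> [/= [n _ Fnx] [k _ Gky]]; exists (maxn n k) => //; split.
    - by move: x Fnx; exact/subsetPset/ndF/leq_maxl.
    - by move: y Gky; exact/subsetPset/ndG/leq_maxr.
  by move=> [n _ []/= ? ?]; split; exists n.
move=> k; have [? ?] := Foo k; have [? ?] := Goo k.
split; first exact: measurableX.
by rewrite product_measure1E// lte_mul_pinfty// ge0_fin_numE.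
Qed.

Section cons_rV.
Context (R : realType) (n : nat).
Local Notation R1 := (measurableTypeR R).

Definition cons_rV (p : R1 * 'rV[R]_n) : 'rV[R]_n.+1 :=
  \row_i oapp (fun j => p.2 0 j) p.1 (unlift ord0 i).

Lemma cons_rV0 p : cons_rV p 0 ord0 = p.1.
Proof. by rewrite mxE unlift_none. Qed.

Lemma cons_rVS p i : cons_rV p 0 (lift ord0 i) = p.2 0 i.
Proof. by rewrite mxE liftK. Qed.

Lemma measurable_cons_rV : measurable_fun [set: R1 * 'rV[R]_n] cons_rV.
Proof.
apply/measurable_fun_rVP => i.
have [->|[j ->]] : i = ord0 \/ exists j, i = lift ord0 j.
- by case: (unliftP ord0 i) => [j ->|->]; [right; exists j|left].
- by under eq_fun do rewrite cons_rV0; exact: measurable_fst.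
- under eq_fun do rewrite cons_rVS.
  apply: (measurableT_comp (measurable_rV_coord j)); exact: measurable_snd.
Qed.

Definition uncons_rV (v : 'rV[R]_n.+1) : R1 * 'rV[R]_n :=
  (v 0 ord0, \row_i v 0 (lift ord0 i)).

Lemma measurable_uncons_rV : measurable_fun [set: 'rV[R]_n.+1] uncons_rV.
Proof.
apply: measurable_fun_pair; first exact: measurable_rV_coord.
apply/measurable_fun_rVP => i; under eq_fun do rewrite mxE.
exact: measurable_rV_coord.
Qed.

Lemma cons_rVK : cancel cons_rV uncons_rV.
Proof.
move=> p; rewrite /uncons_rV cons_rV0 [RHS]surjective_pairing; congr pair.
by apply/rowP => i; rewrite mxE cons_rVS.
Qed.

Lemma uncons_rVK : cancel uncons_rV cons_rV.
Proof.
move=> v; apply/rowP => i.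
by case: (unliftP ord0 i) => [j ->|->]; rewrite ?cons_rVS ?cons_rV0//= mxE.
Qed.

Local Open Scope ereal_scope.
Variable m : {sigma_finite_measure set 'rV[R]_n -> \bar R}.

Definition lebesgue_cons : set 'rV[R]_n.+1 -> \bar R :=
  pushforward (@lebesgue_measure R \x m) cons_rV.

Let lebesgue_cons0 : lebesgue_cons set0 = 0.
Proof. by rewrite /lebesgue_cons /pushforward preimage_set0 measure0. Qed.

Let lebesgue_cons_ge0 A : 0 <= lebesgue_cons A.
Proof. by rewrite /lebesgue_cons /pushforward measure_ge0. Qed.

Let lebesgue_cons_sigma_additive : semi_sigma_additive lebesgue_cons.
Proof.
move=> F mF tF mUF; rewrite /lebesgue_cons /pushforward preimage_bigcup.
apply: measure_semi_sigma_additive.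
- by move=> k; rewrite -[X in measurable X]setTI; exact: measurable_cons_rV.
- apply/trivIsetP => /= i j _ _ ij; rewrite -preimage_setI.
  by move/trivIsetP : tF => /(_ _ _ _ _ ij) ->//; rewrite preimage_set0.
- rewrite -preimage_bigcup -[X in measurable X]setTI.
  exact: measurable_cons_rV.
Qed.

HB.instance Definition _ := isMeasure.Build _ _ _ lebesgue_cons
  lebesgue_cons0 lebesgue_cons_ge0 lebesgue_cons_sigma_additive.

Let lebesgue_cons_sigma_finite : sigma_finite setT lebesgue_cons.
Proof.
have [F TF Foo] := product_measure1_sigma_finite (@lebesgue_measure R) m.
exists (fun k => uncons_rV @^-1` F k).
  by rewrite -preimage_bigcup -TF preimage_setT.
move=> k; have [mF Fk] := Foo k; split.
  by rewrite -[X in measurable X]setTI; exact: measurable_uncons_rV.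
by rewrite /lebesgue_cons /pushforward -comp_preimage (_ : _ \o _ = id) //;
  apply/funext => p /=; rewrite cons_rVK.
Qed.

HB.instance Definition _ := Measure_isSigmaFinite.Build _ _ _ lebesgue_cons
  lebesgue_cons_sigma_finite.

End cons_rV.

(* Dimension 0 gets the unit point mass; each step is the product with the
   one-dimensional Lebesgue measure, transported along cons_rV. *)
Fixpoint lebesgue_rV (R : realType) (n : nat) :
    {sigma_finite_measure set 'rV[R]_n -> \bar R} :=
  match n with
  | 0 => [the {sigma_finite_measure set 'rV[R]_0 -> \bar R} of \d_(0 : 'rV[R]_0)]
  | n'.+1 => [the {sigma_finite_measure set 'rV[R]_n'.+1 -> \bar R} of
               lebesgue_cons (lebesgue_rV R n')]
  end.
Arguments lebesgue_rV {R} n.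

Lemma lebesgue_rV_box (R : realType) n (a b : 'rV[R]_n) :
  (forall i, a 0 i <= b 0 i) ->
  lebesgue_rV n [set x | forall i, a 0 i <= x 0 i <= b 0 i] =
  (\prod_(i < n) (b 0 i - a 0 i))%:E.
Proof.
elim: n a b => [|n IH] a b ab.
  rewrite big_ord0 /= diracE (_ : _ \in _ = true)//; apply/mem_set => -[].
  by [].
pose a' : 'rV[R]_n := \row_i a 0 (lift ord0 i).
pose b' : 'rV[R]_n := \row_i b 0 (lift ord0 i).
rewrite big_ord_recl /= /lebesgue_cons /pushforward.
rewrite (_ : cons_rV (n:=n) @^-1` _ = `[a 0 ord0, b 0 ord0]%classic `*`
    [set x : 'rV[R]_n | forall i, a' 0 i <= x 0 i <= b' 0 i]); last first.
  apply/seteqP; split => -[x y] /=.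
  - move=> H; split => /=.
      by have := H ord0; rewrite cons_rV0 in_itv.
    by move=> i; have := H (lift ord0 i); rewrite cons_rVS !mxE.
  - rewrite in_itv /= => -[H1 H2] i; case: (unliftP ord0 i) => [j ->|->].
    + by have := H2 j; rewrite cons_rVS !mxE.
    + by rewrite cons_rV0.
rewrite product_measure1E//=; last first.
  rewrite (_ : mkset _ =
    \bigcap_(i in [set: 'I_n]) [set x : 'rV_n | a' 0 i <= x 0 i <= b' 0 i]); last first.
    by apply/seteqP; split => x /= H i; [move=> _|]; exact: H.
  apply: fin_bigcap_measurable => // i _.
  rewrite (_ : mkset _ = setT `&` (fun x : 'rV[R]_n => x 0 i) @^-1` `[a' 0 i, b' 0 i]%classic).
    exact: measurable_rV_coord.
  by apply/seteqP; split => x /=; rewrite in_itv /= => // -[].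
rewrite lebesgue_measure_itv /= lte_fin IH => [|i]; last by rewrite !mxE.
rewrite (eq_bigr (fun i => b 0 (lift ord0 i) - a 0 (lift ord0 i))); last first.
  by move=> i _; rewrite !mxE.
have := ab ord0; rewrite le_eqVlt => /orP[/eqP ->|->].
  by rewrite ltxx subrr mul0r mul0e.
by rewrite -EFinM.
Qed.

Section ell2.
Context {R : realType}.
Implicit Types (u : nat -> R[i]).

Definition cseries u : R[i] :=
  Complex (limn (series (fun n => complex.Re (u n))))
          (limn (series (fun n => complex.Im (u n)))).

Definition ell2_sq u : \bar R := (\sum_(i <oo) ((normc (u i)) ^+ 2)%:E)%E.
Definition ell2 u : Prop := (ell2_sq u < +oo)%E.
Definition ell2_norm u : R := Num.sqrt (fine (ell2_sq u)).

Definition ell2_unit (j : nat) : nat -> R[i] := fun i => (i == j)%:R.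

(* A bounded operator on l^2(N), represented by a total map on sequences whose
   values outside l^2(N) are irrelevant. *)
Record ell2_op := Ell2Op {
  ell2_fun :> (nat -> R[i]) -> nat -> R[i] ;
  ell2_fun_linear : forall (a : R[i]) u v, ell2 u -> ell2 v ->
    forall n, ell2_fun (fun m => a * u m + v m) n
              = a * ell2_fun u n + ell2_fun v n ;
  ell2_fun_bounded : exists K : R, forall u, ell2 u ->
    ell2 (ell2_fun u) /\ ell2_norm (ell2_fun u) <= K * ell2_norm u }.

Definition ell2_opnorm (T : ell2_op) : R :=
  sup [set ell2_norm (T u) | u in [set u | ell2 u /\ ell2_norm u <= 1]].

Definition ell2_entry (T : ell2_op) (i j : nat) : R[i] := T (ell2_unit j) i.

End ell2.
Arguments ell2_op : clear implicits.

Section spaces.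
Context {R : realType} {d : nat} (Omega : set 'rV[R]_d).
Local Notation mu := (lebesgue_rV d).
Local Notation cfun := ('rV[R]_d -> R[i]).
Local Open Scope complex_scope.

Definition cintegral (f : cfun) : R[i] :=
  Complex (\int[mu]_(x in Omega) complex.Re (f x))
          (\int[mu]_(x in Omega) complex.Im (f x)).

(* Measurability for the completed sigma-algebra: f agrees almost everywhere
   on Omega with a Borel function. *)
Definition lebesgue_measurable (f : cfun) : Prop :=
  exists g : cfun, [/\ measurable_fun Omega (fun x => complex.Re (g x)),
    measurable_fun Omega (fun x => complex.Im (g x)) &
    {ae mu, forall x, Omega x -> f x = g x}].

Definition L2_sq (f : cfun) : \bar R :=
  (\int[mu]_(x in Omega) ((normc (f x)) ^+ 2)%:E)%E.

Definition in_L2 (f : cfun) : Prop :=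
  lebesgue_measurable f /\ (L2_sq f < +oo)%E.

Definition in_H (psi : nat -> cfun) : Prop :=
  (forall i, in_L2 (psi i)) /\ (\sum_(i <oo) L2_sq (psi i) < +oo)%E.

Definition inner_H (psi phi : nat -> cfun) : R[i] :=
  cseries (fun i => cintegral (fun x => psi i x * (phi i x)^*)).

Definition inner_Hd (psi phi : 'I_d -> nat -> cfun) : R[i] :=
  \sum_(k < d) inner_H (psi k) (phi k).

Definition partial (k : 'I_d) (f : 'rV[R]_d -> R) : 'rV[R]_d -> R :=
  fun x => 'D_(delta_mx 0 k) f x.

Definition smooth (f : 'rV[R]_d -> R) : Prop :=
  forall (s : seq 'I_d) x, differentiable (foldr partial f s) x.

Definition test_function (f : 'rV[R]_d -> R) : Prop :=
  smooth f /\ exists K, [/\ compact K, K `<=` Omega &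
    forall x, ~ K x -> f x = 0].

Definition weak_partial (k : 'I_d) (u g : cfun) : Prop :=
  forall f, test_function f ->
    cintegral (fun x => u x * (partial k f x)%:C)
    = - cintegral (fun x => g x * (f x)%:C).

(* A function of H^1(Omega) is carried along with a representative g of its
   weak gradient, which it determines up to null sets. *)
Definition in_H1 (u : cfun) (g : 'I_d -> cfun) : Prop :=
  in_L2 u /\ forall k, in_L2 (g k) /\ weak_partial k u (g k).

Definition H1_sq (u : cfun) (g : 'I_d -> cfun) : \bar R :=
  (L2_sq u + \sum_(k < d) L2_sq (g k))%E.

Record Vfun := MkVfun {
  Vval : nat -> cfun ;
  Vgrad : 'I_d -> nat -> cfun }.
Implicit Types psi phi : Vfun.

Definition V_sq psi : \bar R :=
  (\sum_(i <oo) H1_sq (Vval psi i) (fun k => Vgrad psi k i))%E.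

Definition in_V psi : Prop :=
  (forall i, in_H1 (Vval psi i) (fun k => Vgrad psi k i)) /\
  (V_sq psi < +oo)%E.

Definition V_norm psi : R := Num.sqrt (fine (V_sq psi)).

Definition V_lincomb (a : R[i]) psi phi : Vfun :=
  MkVfun (fun i x => a * Vval psi i x + Vval phi i x)
         (fun k i x => a * Vgrad psi k i x + Vgrad phi k i x).

Definition finite_sequence psi : Prop :=
  exists N, forall i, (N <= i)%N ->
    {ae mu, forall x, Omega x ->
      Vval psi i x = 0 /\ forall k, Vgrad psi k i x = 0}.

Definition sesquilinear_on_V (a : Vfun -> Vfun -> R[i]) : Prop :=
  forall (c : R[i]) psi phi chi, in_V psi -> in_V phi -> in_V chi ->
    a (V_lincomb c psi phi) chi = c * a psi chi + a phi chi /\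
    a chi (V_lincomb c psi phi) = c^* * a chi psi + a chi phi.

Definition continuous_on_V (a : Vfun -> Vfun -> R[i]) : Prop :=
  exists M : R, forall psi phi, in_V psi -> in_V phi ->
    normc (a psi phi) <= M * V_norm psi * V_norm phi.

Variable C : 'rV[R]_d -> ell2_op R.

Definition componentwise_measurable : Prop :=
  forall i j, lebesgue_measurable (fun x => ell2_entry (C x) i j).

Definition ess_uniformly_bounded : Prop :=
  exists2 M : R, 0 <= M &
    {ae mu, forall x, Omega x -> ell2_opnorm (C x) <= M}.

Definition mult_op (psi : nat -> cfun) : nat -> cfun :=
  fun n x => cseries (fun m => ell2_entry (C x) n m * psi m x).

Definition mult_op_dom (psi : nat -> cfun) : Prop :=
  in_H psi /\ in_H (mult_op psi).

Definition form (psi phi : Vfun) : R[i] :=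
  inner_Hd (fun k => mult_op (Vgrad psi k)) (Vgrad phi).

(* The form is given by its formula on finite sequences only; being continuous
   on V x V means that it is defined there and extends to a (necessarily
   unique) continuous sesquilinear form on V. *)
Definition form_continuous : Prop :=
  (forall psi, in_V psi -> finite_sequence psi ->
     forall k, mult_op_dom (Vgrad psi k)) /\
  exists a : Vfun -> Vfun -> R[i],
    [/\ sesquilinear_on_V a, continuous_on_V a &
      forall psi phi, in_V psi -> in_V phi ->
        finite_sequence psi -> finite_sequence phi ->
        a psi phi = form psi phi].

End spaces.

(* Main.v *)
Require Import Defs.
From mathcomp Require Import all_boot all_order all_algebra.
From mathcomp Require Import complex ring lra.
From mathcomp Require Import all_classical all_reals all_analysis.
From mathcomp Require Import measurable_realfun.

(** Let K be an upper bound of the norms of the operators C (x). Applying C (x)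
    pointwise to the sequence of the derivatives of psi multiplies its square sum
    by at most K^2. Integrating (Tonelli) bounds the multiplication operator on
    the direct sum ([mult_op_bounded]), and the Cauchy-Schwarz inequality bounds
    the form ([form_continuous_of_bounded]).

    Conversely, let the form be continuous. It is tested on elementary tensors:
    a finitely supported vector times a real function u. For two vectors xi and
    zeta the form is the integral of Re (C (x) xi | zeta) |grad u (x)|^2
    ([cRe_form_tensor]), and continuity bounds it by a multiple of
    (|xi|^2 + |zeta|^2) times the squared H^1 norm of u. Take
    u = cos (s x_0) eta and u = sin (s x_0) eta and add the two inequalities.
    The mixed terms cancel, so that |grad u|^2 contributes exactly
    s^2 eta^2 + |grad eta|^2 ([partial_wave_sqr]). Both sides are then quadratic
    polynomials in s, and comparing the leading coefficients yields

      int eta^2 Re (C xi | zeta) <= K (|xi|^2 + |zeta|^2) int eta^2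

    for every cutoff function eta. In this high-frequency limit the form, which
    sees gradients only, has become a form on L^2. As indicators of Borel sets
    are limits of cutoffs ([measurable_approximable]), the inequality holds
    pointwise almost everywhere ([ae_ge0_of_cutoff]); one null set suffices for
    all vectors with rational coordinates, and by density for all vectors
    ([sesqui_rat_dense]). This bounds the operator norms by 2 K
    ([ell2_opnorm_sesqui_le]).

    The finite measure of Omega enters through the waves: since cos (x_0) and
    sin (x_0) belong to H^1, the domain condition shows that every entry of C is
    square integrable, hence integrable ([entry_integrable]), so that all the
    integrals above make sense. That the classical derivatives of the bounded
    functions u are their weak derivatives rests on the integral of a partial
    derivative of a compactly supported function being zero
    ([integral_partial0]), which follows from the translation invariance of the
    measure, applied to difference quotients. *)

Set Implicit Arguments.
Unset Strict Implicit.
Unset Printing Implicit Defensive.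

Import Order.TTheory GRing.Theory Num.Theory.
Import numFieldNormedType.Exports.
Import ComplexField.Normc.

Local Open Scope classical_set_scope.
Local Open Scope ring_scope.

Local Notation cRe := complex.Re.
Local Notation cIm := complex.Im.
Local Notation conjc := (@complex.conjc _).

(** * Complex coordinates and almost everywhere equal integrands *)

Section complex_coordinates.
Context {R : realType}.
Implicit Types x y z : R[i].

Lemma cReD x y : cRe (x + y) = cRe x + cRe y.
Proof. by case: x; case: y. Qed.
Lemma cImD x y : cIm (x + y) = cIm x + cIm y.
Proof. by case: x; case: y. Qed.
Lemma cReN x : cRe (- x) = - cRe x.
Proof. by case: x. Qed.
Lemma cImN x : cIm (- x) = - cIm x.
Proof. by case: x. Qed.
Lemma cReM x y : cRe (x * y) = cRe x * cRe y - cIm x * cIm y.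
Proof. by case: x; case: y. Qed.
Lemma cImM x y : cIm (x * y) = cRe x * cIm y + cIm x * cRe y.
Proof. by case: x; case: y. Qed.
Lemma cReJ x : cRe (conjc x) = cRe x.
Proof. by case: x. Qed.
Lemma cImJ x : cIm (conjc x) = - cIm x.
Proof. by case: x. Qed.
Definition cE := (cReD, cImD, cReN, cImN, cReM, cImM, cReJ, cImJ).

Lemma complex_ext x y : cRe x = cRe y -> cIm x = cIm y -> x = y.
Proof. by case: x; case: y => a b c d /= -> ->. Qed.

Lemma cRe_sum (I : Type) (s : seq I) (P : pred I) (F : I -> R[i]) :
  cRe (\sum_(i <- s | P i) F i) = \sum_(i <- s | P i) cRe (F i).
Proof. exact: (big_morph _ cReD erefl). Qed.

Lemma cIm_sum (I : Type) (s : seq I) (P : pred I) (F : I -> R[i]) :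
  cIm (\sum_(i <- s | P i) F i) = \sum_(i <- s | P i) cIm (F i).
Proof. exact: (big_morph _ cImD erefl). Qed.

Lemma normc_sqr z : normc z ^+ 2 = cRe z ^+ 2 + cIm z ^+ 2.
Proof. by case: z => a b /=; rewrite sqr_sqrtr// addr_ge0 ?sqr_ge0. Qed.

Lemma normc_ge0 z : 0 <= normc z.
Proof. by case: z => a b; exact: sqrtr_ge0. Qed.

Lemma normr_cRe z : `|cRe z| <= normc z.
Proof.
rewrite -(@ler_pXn2r _ 2)// ?nnegrE ?normc_ge0// normc_sqr.
by rewrite real_normK ?num_real// lerDl sqr_ge0.
Qed.

Lemma normr_cIm z : `|cIm z| <= normc z.
Proof.
rewrite -(@ler_pXn2r _ 2)// ?nnegrE ?normc_ge0// normc_sqr.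
by rewrite real_normK ?num_real// lerDr sqr_ge0.
Qed.

Lemma normc_le_ReIm z : normc z <= `|cRe z| + `|cIm z|.
Proof.
rewrite -(@ler_pXn2r _ 2)// ?nnegrE ?normc_ge0// ?addr_ge0// normc_sqr.
rewrite sqrrD !real_normK ?num_real//.
by rewrite addrAC lerDl mulrn_wge0// mulr_ge0.
Qed.

End complex_coordinates.

Section ae_integral.
Context d (T : measurableType d) (R : realType).
Variable mu : {measure set T -> \bar R}.
Local Open Scope ereal_scope.
Import HBNNSimple.

Let ge0_ae_le (D : set T) (f g : T -> \bar R) :
  (forall x, D x -> 0 <= f x) -> (forall x, D x -> 0 <= g x) ->
  {ae mu, forall x, D x -> f x = g x} ->
  \int[mu]_(x in D) f x <= \int[mu]_(x in D) g x.
Proof.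
move=> f0 g0 [N [mN N0 fgN]].
rewrite (integral_mkcond D f) (integral_mkcond D g) !ge0_integralTE; last 2 first.
- by move=> x; rewrite /patch; case: ifPn => //; rewrite inE => /g0.
- by move=> x; rewrite /patch; case: ifPn => //; rewrite inE => /f0.
apply: ge_ereal_sup => _ [h /= hf <-].
have mh : measurable_fun setT (fun x => (h x)%:E : \bar R).
  exact/measurable_EFinP/measurable_funPT.
rewrite -integralT_nnsfun (@ge0_negligible_integral _ _ _ mu _ N)//; last first.
  by move=> x _; rewrite lee_fin.
rewrite setTD integral_mkcond.
rewrite ge0_integralTE; last first.
  by move=> x; rewrite /patch; case: ifPn => //; rewrite lee_fin.
apply: ge_ereal_sup => _ [k /= kh <-]; apply: ereal_sup_ubound; exists k => //=.
move=> x; apply: (le_trans (kh x)); rewrite /patch; case: ifPn => [|_].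
  rewrite inE /= => Nx; apply: (le_trans (hf x)); rewrite /patch.
  case: ifPn => //; rewrite inE => Dx.
  have -> // : f x = g x.
  by apply: contrapT => fg; apply: Nx; apply: fgN => /= /(_ Dx).
by case: ifPn => //; rewrite inE => /g0.
Qed.

(** The integral is defined for all functions, measurable or not; a simple
    function below f, once killed on the exceptional null set, is below g. *)
Lemma ge0_ae_eq_integral_nonmeasurable (D : set T) (f g : T -> \bar R) :
  (forall x, D x -> 0 <= f x) -> (forall x, D x -> 0 <= g x) ->
  {ae mu, forall x, D x -> f x = g x} ->
  \int[mu]_(x in D) f x = \int[mu]_(x in D) g x.
Proof.
move=> f0 g0 fg; apply/eqP; rewrite eq_le !ge0_ae_le//.
by apply: filterS fg => x + Dx => ->.
Qed.

Lemma ae_eq_Rintegral (D : set T) (f g : T -> R) :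
  {ae mu, forall x, D x -> f x = g x} ->
  (\int[mu]_(x in D) f x = \int[mu]_(x in D) g x)%R.
Proof.
move=> fg; rewrite /Rintegral integralE [in RHS]integralE; congr (fine (_ - _));
  (apply: ge0_ae_eq_integral_nonmeasurable => //;
   apply: filterS fg => x + Dx => /(_ Dx) fgx; rewrite ?funeposE ?funenegE fgx //).
Qed.

End ae_integral.

(** * Borel sets and translations of coordinate space *)

Section borel_rV.
Context {R : realType} {n : nat}.
Implicit Types (A : set 'rV[R]_n) (x v : 'rV[R]_n).

Let cube (c : 'rV[rat]_n) (r : R) : set 'rV[R]_n :=
  [set x | forall i, `|ratr (c 0 i) - x 0 i| < r].

Let measurable_cube c r : measurable (cube c r).
Proof.
rewrite (_ : cube c r = \bigcap_(i in [set: 'I_n])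
    [set x : 'rV[R]_n | `|ratr (c 0 i) - x 0 i| < r]); last first.
  by apply/seteqP; split => x /= H i; [move=> _|]; exact: H.
apply: fin_bigcap_measurable => // i _.
rewrite (_ : mkset _ = setT `&`
    (fun x : 'rV[R]_n => x 0 i) @^-1` [set t | `|ratr (c 0 i) - t| < r]); last first.
  by apply/seteqP; split => x //= -[].
apply: measurable_rV_coord => //; apply: open_measurable.
rewrite (_ : mkset _ = ball (ratr (c 0 i) : R) r); first exact: ball_open.
by apply/seteqP; split.
Qed.

(** A point of an open set lies in a small cube with rational centre that stays
    in the set, so an open set is a countable union of such cubes. *)
Lemma open_measurable_rV A : open A -> measurable A.
Proof.
move=> oA.
pose F (p : 'rV[rat]_n * nat) : set 'rV[R]_n :=
  if pselect (cube p.1 p.2.+1%:R^-1 `<=` A) then cube p.1 p.2.+1%:R^-1 else set0.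
have -> : A = \bigcup_p F p.
  apply/seteqP; split => [x Ax|x [p _]]; last first.
    by rewrite /F; case: pselect => //= pA; exact: pA.
  have /nbhs_ballP[e /= e0 xeA] : nbhs x A by exact: open_nbhs_nbhs.
  have [k ke] : exists k, k.+1%:R^-1 < e / 2.
    have e20 : 0 < e / 2 by rewrite divr_gt0.
    have /cvgr0_norm_lt /(_ _ e20)[k _ /(_ k (leqnn k)) /= H] := @cvg_harmonic R.
    by exists k; apply: le_lt_trans H; exact: ler_norm.
  have k0 : 0 < k.+1%:R^-1 :> R by rewrite invr_gt0.
  have qP i : {q : rat | `|ratr q - x 0 i| < k.+1%:R^-1}.
    apply: cid; have : x 0 i - k.+1%:R^-1 < x 0 i + k.+1%:R^-1.
      by rewrite ltrD2l gtrN.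
    move=> /rat_in_itvoo[q]; rewrite in_itv /= => /andP[q1 q2]; exists q.
    rewrite ltr_norml; move: q1 q2; move: (ratr q) (k.+1%:R^-1) => a b ? ?.
    by apply/andP; split; lra.
  have qE i : ratr ((\row_j sval (qP j)) 0 i) = ratr (sval (qP i)) :> R.
    by rewrite mxE.
  exists (\row_i sval (qP i), k) => //; rewrite /F /=; case: pselect => [_|] /=.
    by move=> i; rewrite qE; exact: svalP (qP i).
  apply => y cy; apply: xeA; split=> // i j; rewrite (ord1 i) /=.
  have := cy j; rewrite qE; have := svalP (qP j).
  move: (ratr _) => q; move: (k.+1%:R^-1) ke => h ke.
  rewrite /ball /= !ltr_norml => /andP[? ?] /andP[? ?].
  by apply/andP; split; lra.
apply: countable_bigcupT_measurable; first exact: countableP.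
by move=> p; rewrite /F; case: pselect => //= _; exact: measurable_cube.
Qed.

Lemma continuous_measurable_fun_rV (f : 'rV[R]_n -> R) :
  continuous f -> measurable_fun [set: 'rV[R]_n] f.
Proof.
move=> /continuousP cf; apply: (measurability _ (RGenOInfty.measurableE R)).
move=> /= _ [_ [a ->]] <-; rewrite setTI; apply: open_measurable_rV.
by apply: cf; exact: interval_open.
Qed.

Lemma measurable_shift_rV v : measurable_fun [set: 'rV[R]_n] (fun x => x + v).
Proof.
apply/measurable_fun_rVP => i; under eq_fun do rewrite mxE.
by apply: measurable_funD => //; exact: measurable_rV_coord.
Qed.

End borel_rV.

Section translation.
Context {R : realType}.
Local Open Scope ereal_scope.
Local Notation R1 := (measurableTypeR R).

Lemma lebesgue_measure_shift (t : R) (A : set R1) : measurable A ->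
  lebesgue_measure ((fun x : R1 => (x + t)%R) @^-1` A) = lebesgue_measure A.
Proof.
have mt : measurable_fun [set: R1] (fun x : R1 => (x + t)%R : R1).
  by apply: measurable_funD.
move=> mA; apply/esym.
apply: (@lebesgue_measure_unique R
  (measure_function_pushforward__canonical__measure_function_Measure _ mt)) => //.
move=> _ [[a b]] _ <-; rewrite /= /pushforward.
rewrite (_ : _ @^-1` _ = `]a - t, b - t]%classic)%R; last first.
  apply/seteqP; split => x /=; rewrite !in_itv /= => /andP[? ?];
    by apply/andP; split; lra.
rewrite !lebesgue_measure_itv /= !lte_fin ltrD2r.
by case: ifP => // _; rewrite -!EFinD; congr EFin; ring.
Qed.

(** By induction on the dimension: both sides of the product measure are
    invariant, and a measure on the product is determined on rectangles. *)
Lemma lebesgue_rV_shift n (v : 'rV[R]_n) (A : set 'rV[R]_n) : measurable A ->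
  lebesgue_rV n ((fun x => x + v)%R @^-1` A) = lebesgue_rV n A.
Proof.
elim: n v A => [|n IH] v A mA.
  by congr (lebesgue_rV 0 _); apply/seteqP; split => x /=; rewrite (thinmx0 (x + v)%R) (thinmx0 x).
rewrite /= /lebesgue_cons /pushforward.
pose w : 'rV[R]_n := (\row_i v 0 (lift ord0 i))%R.
pose s (p : R1 * 'rV[R]_n) : R1 * 'rV[R]_n := (p.1 + v 0 ord0, p.2 + w)%R.
have ms : measurable_fun setT s.
  apply: measurable_fun_pair.
    by apply: measurable_funD => //; exact: measurable_fst.
  exact: measurableT_comp (measurable_shift_rV w) measurable_snd.
have mcA : measurable (cons_rV (n := n) @^-1` A).
  by rewrite -[X in measurable X]setTI; exact: measurable_cons_rV.
rewrite -comp_preimage (_ : _ \o _ = cons_rV (n := n) \o s); last first.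
  apply/funext => p; apply/rowP => i; rewrite /= mxE.
  case: (unliftP ord0 i) => [j ->|->].
    by rewrite !cons_rVS /= !mxE.
  by rewrite !cons_rV0.
rewrite comp_preimage; apply/esym.
apply: (@product_measure_unique _ _ _ _ R lebesgue_measure (lebesgue_rV n)
  (measure_function_pushforward__canonical__measure_function_Measure _ ms)) => //.
move=> B D mB mD; rewrite /= /pushforward.
rewrite (_ : s @^-1` (B `*` D) = ((fun x : R1 => x + v 0 ord0)%R @^-1` B) `*`
    ((fun x => x + w)%R @^-1` D)); last by apply/seteqP; split.
rewrite product_measure1E//=.
- by rewrite IH// lebesgue_measure_shift.
- rewrite -[X in measurable X]setTI; have mt : measurable_fun [set: R1] (fun x : R1 => (x + v 0 ord0)%R : R1).
    by apply: measurable_funD.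
  exact: mt.
- by rewrite -[X in measurable X]setTI; exact: measurable_shift_rV.
Qed.

Lemma Rintegral_shift n (v : 'rV[R]_n) (f : 'rV[R]_n -> R) :
  (lebesgue_rV n).-integrable setT (EFin \o f) ->
  (lebesgue_rV n).-integrable setT (EFin \o (fun x => f (x + v)%R)) /\
  (\int[lebesgue_rV n]_x f (x + v) = \int[lebesgue_rV n]_x f x)%R.
Proof.
move=> fi; have mf := measurable_int _ fi.
have mv := @measurable_shift_rV R n v.
have E (g : 'rV[R]_n -> \bar R) : \int[lebesgue_rV n]_x g x =
    \int[measure_function_pushforward__canonical__measure_function_Measure (lebesgue_rV n) mv]_x g x.
  by apply: eq_measure_integral => A mA _ /=; rewrite /pushforward lebesgue_rV_shift.
have fi' : (lebesgue_rV n).-integrable setT (EFin \o (fun x => f (x + v)%R)).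
  apply/integrableP; split; first exact: measurableT_comp mf mv.
  move/integrableP : fi => [_]; rewrite E ge0_integral_pushforward//.
  exact: measurableT_comp.
split => //; rewrite /Rintegral [in RHS]E integral_pushforward//.
Qed.

End translation.

(** * Bounded Lipschitz functions and their partial derivatives *)

Section tame_functions.
Context {R : realType} {n : nat}.
Local Notation mu := (@lebesgue_rV R n).
Local Notation "''e_' k" := (delta_mx 0 k : 'rV[R]_n) (at level 8, format "''e_' k").
Implicit Types (f g w : 'rV[R]_n -> R) (k : 'I_n) (x : 'rV[R]_n).

(** A class closed under products that contains the test functions, the waves
    cos (s x_0), sin (s x_0) and the logistic cutoffs. No decay is demanded: on a
    set of finite measure bounded functions are square integrable. *)
Definition tame f : Prop :=
  [/\ measurable_fun setT f,
      exists B : R, forall x, `|f x| <= B,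
      exists L : R, forall k x h, `|f (x + h *: 'e_k) - f x| <= L * `|h| &
      forall k x, derivable f x 'e_k].

Definition dquot k (m : nat) f x : R := m.+1%:R * (f (x + m.+1%:R^-1 *: 'e_k) - f x).

Lemma cvg_dquot k f x : derivable f x 'e_k ->
  dquot k ^~ f ^~ x @ \oo --> partial k f x.
Proof.
move=> df; have {}df : h^-1 *: ((f \o shift x) (h *: 'e_k) - f x) @[h --> 0^'] -->
    partial k f x by [].
have hc : (fun m => m.+1%:R^-1 : R) @ \oo --> 0^'.
  move=> A A0; have H : \forall m \near \oo, m.+1%:R^-1 != 0 :> R -> A m.+1%:R^-1.
    exact: (@cvg_harmonic R (fun y => y != 0 -> A y) A0).
  by apply: filterS H => m; apply; rewrite gt_eqF// invr_gt0.
have := cvg_comp _ _ hc df; apply: cvg_trans; apply: near_eq_cvg; near=> m.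
by rewrite /dquot /= invrK (addrC x).
Unshelve. all: by end_near. Qed.

Lemma measurable_dquot k m f : measurable_fun setT f ->
  measurable_fun setT (dquot k m f).
Proof.
move=> mf; apply: measurable_funM => //; apply: measurable_funB => //.
exact: measurableT_comp mf (measurable_shift_rV _).
Qed.

Lemma tame_partial_measurable k f : tame f -> measurable_fun setT (partial k f).
Proof.
move=> [mf _ _ df]; apply: (@measurable_fun_cvg _ _ _ _ (fun m => dquot k m f)).
  by move=> m; exact: measurable_dquot.
by move=> x _; exact: cvg_dquot.
Qed.

Lemma dquot_le k m f L : (forall k x h, `|f (x + h *: 'e_k) - f x| <= L * `|h|) ->
  forall x, `|dquot k m f x| <= L.
Proof.
move=> fL x; rewrite /dquot normrM (ger0_norm (ler0n _ _)).
rewrite -ler_pdivlMl// mulrC.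
by apply: (le_trans (fL _ _ _)); rewrite ger0_norm ?invr_ge0.
Qed.

Lemma tame_partial_le k f L : tame f ->
  (forall k x h, `|f (x + h *: 'e_k) - f x| <= L * `|h|) ->
  forall x, `|partial k f x| <= L.
Proof.
move=> [_ _ _ df] fL x.
have cn : (fun m => `|dquot k m f x|) @ \oo --> `|partial k f x|.
  by apply: cvg_norm; exact: cvg_dquot.
rewrite -(cvg_lim _ cn)//; apply: limr_le; first by apply: cvgP cn.
by apply: nearW => m; exact: dquot_le.
Qed.

Lemma tame_partial_bounded k f : tame f -> exists B : R, forall x, `|partial k f x| <= B.
Proof. by move=> tf; have [_ _ [L fL] _] := tf; exists L; exact: tame_partial_le. Qed.

Lemma tame_cst (c : R) : tame (cst c).
Proof.
split => //; first by exists `|c|.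
- by exists 0 => k x h; rewrite subrr normr0 mul0r.
Qed.

Lemma tameM f g : tame f -> tame g -> tame (fun x => f x * g x).
Proof.
move=> [mf [B fB] [L fL] df] [mg [B' gB] [L' gL] dg]; split.
- exact: measurable_funM.
- by exists (B * B') => x; rewrite normrM ler_pM.
- exists (L * B' + B * L') => k x h.
  rewrite (_ : _ - _ = (f (x + h *: 'e_k) - f x) * g (x + h *: 'e_k)
    + f x * (g (x + h *: 'e_k) - g x)); last by ring.
  apply: (le_trans (ler_normD _ _)); rewrite !normrM mulrDl lerD//.
    by rewrite mulrAC ler_pM.
  by rewrite -mulrA ler_pM.
- by move=> k x; exact: derivableM.
Qed.

Lemma partialM k f g x : tame f -> tame g ->
  partial k (fun x => f x * g x) x = f x * partial k g x + g x * partial k f x.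
Proof. by move=> [_ _ _ df] [_ _ _ dg]; rewrite /partial deriveM. Qed.

Lemma tame_onem f : tame f -> tame (fun x => 1 - f x).
Proof.
move=> [mf [B fB] [L fL] df]; split.
- exact: measurable_funB.
- by exists (1 + B) => x; rewrite (le_trans (ler_normB _ _))// normr1 lerD2l.
- exists L => k x h; rewrite (_ : _ - _ = - (f (x + h *: 'e_k) - f x)); last by ring.
  by rewrite normrN.
- by move=> k x; apply: derivableB => //; exact: derivable_cst.
Qed.

Lemma lipschitz_line (h h' : R -> R) (L : R) :
  (forall t : R, is_derive t 1 h (h' t)) -> (forall t, `|h' t| <= L) ->
  forall a b, `|h b - h a| <= L * `|b - a|.
Proof.
move=> dh hL a b; wlog ab : a b / a <= b.
  move=> H; have [|/ltW] := leP a b; first exact: H.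
  by rewrite distrC [X in _ * X]distrC; exact: H.
have ch : {within `[a, b], continuous h}.
  apply: continuous_subspaceT => t; apply: differentiable_continuous.
  by apply/derivable1_diffP; have [] := dh t.
have [c _ ->] := MVT_segment ab (fun t _ => dh t) ch.
by rewrite normrM ler_wpM2r.
Qed.

Lemma is_derive_coord (h : R -> R) (dh : R) (i k : 'I_n) x :
  is_derive (x 0 i) 1 h dh ->
  is_derive x 'e_k (fun y => h (y 0 i)) ((i == k)%:R * dh).
Proof.
move=> [Dh Eh].
have [ik|ik] := eqVneq i k; rewrite ?mul1r ?mul0r.
  subst i.
  have E : (fun t : R => t^-1 *: (((fun y => h (y 0 k)) \o shift x) (t *: 'e_k) - h (x 0 k)))
      = (fun t : R => t^-1 *: ((h \o shift (x 0 k)) (t *: 1) - h (x 0 k))).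
    by apply/funext => t /=; rewrite !mxE !eqxx.
  by split; rewrite /derivable /derive /= E.
have E : (fun t : R => t^-1 *: (((fun y => h (y 0 i)) \o shift x) (t *: 'e_k) - h (x 0 i)))
    = cst 0.
  by apply/funext => t /=; rewrite !mxE (negbTE ik) mulr0 add0r subrr scaler0.
split; rewrite /derivable /derive /= E; first exact: is_cvg_cst.
exact: lim_cst.
Qed.

(** The Lipschitz bound is the mean value theorem on the line through x in the
    direction of a coordinate; moving another coordinate changes nothing. *)
Lemma tame_coord (h h' : R -> R) (B L : R) (i : 'I_n) :
  (forall t : R, is_derive t 1 h (h' t)) -> (forall t, `|h t| <= B) ->
  (forall t, `|h' t| <= L) -> tame (fun x => h (x 0 i)).
Proof.
move=> dh hB hL; have L0 : 0 <= L := le_trans (normr_ge0 _) (hL 0).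
split.
- apply: (measurableT_comp _ (measurable_rV_coord i)).
  apply: continuous_measurable_fun => t; apply: differentiable_continuous.
  by apply/derivable1_diffP; have [] := dh t.
- by exists B.
- exists L => k x t; apply: (le_trans (lipschitz_line dh hL _ _)).
  rewrite ler_wpM2l// !mxE addrAC subrr add0r eqxx /= normrM.
  by rewrite ler_piMr//; case: eqP; rewrite ?normr1 ?normr0.
- by move=> k x; have [] := is_derive_coord k (dh (x 0 i)).
Qed.

Lemma partial_coord (h h' : R -> R) (i k : 'I_n) x :
  (forall t : R, is_derive t 1 h (h' t)) ->
  partial k (fun y => h (y 0 i)) x = (i == k)%:R * h' (x 0 i).
Proof. by move=> dh; have [] := is_derive_coord k (dh (x 0 i)). Qed.

Lemma bounded_integrable d (T : measurableType d) (nu : {measure set T -> \bar R})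
    (A : set T) (f : T -> R) (B : R) :
  measurable A -> (nu A < +oo)%E -> measurable_fun A f ->
  (forall x : T, A x -> `|f x| <= B) -> nu.-integrable A (EFin \o f).
Proof.
move=> mA Aoo mf fB; apply: measurable_bounded_integrable => //.
by exists B; split; [exact: num_real|] => M BM x Ax; exact: le_trans (fB _ Ax) (ltW BM).
Qed.

Definition vanishes_off_box (r : R) f := forall x, (exists i, r < `|x 0 i|) -> f x = 0.

Let box (r : R) : set 'rV[R]_n :=
  [set x | forall i, (const_mx (- r) : 'rV[R]_n) 0 i <= x 0 i <= (const_mx r : 'rV[R]_n) 0 i].

Let measurable_box r : measurable (box r).
Proof.
rewrite (_ : box r = \bigcap_(i in [set: 'I_n])
    [set x : 'rV[R]_n | x 0 i \in `[- r, r]]); last first.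
  apply/seteqP; split => x /= H i; [move=> _|]; have := H i; rewrite /= in_itv /= !mxE //.
  exact.
apply: fin_bigcap_measurable => // i _.
rewrite (_ : mkset _ = setT `&` (fun x : 'rV[R]_n => x 0 i) @^-1` [set` `[- r, r]]).
  exact: measurable_rV_coord.
by apply/seteqP; split => x //= -[].
Qed.

Let box_lty r : (mu (box r) < +oo)%E.
Proof.
have [r0|r0] := leP 0 r; last first.
  apply: le_lt_trans (_ : (mu (box 0) < +oo)%E).
    apply: le_measure; rewrite ?inE//; try exact: measurable_box.
    by move=> x H i; have := H i; rewrite !mxE; lra.
  by rewrite lebesgue_rV_box ?ltry// => i; rewrite !mxE oppr0.
by rewrite lebesgue_rV_box ?ltry// => i; rewrite !mxE; lra.
Qed.

Let off_box r f : vanishes_off_box r f -> f \_ (box r) = f.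
Proof.
move=> fr; apply/funext => x; rewrite /patch; case: ifPn => //.
rewrite notin_setE => nbx; rewrite fr//; apply: contrapT => H; apply: nbx => i.
have : ~ r < `|x 0 i| by move=> ri; apply: H; exists i.
by move=> /negP; rewrite -leNgt ler_norml !mxE.
Qed.

Lemma vanishes_off_box_integrable r f (B : R) : measurable_fun setT f ->
  (forall x, `|f x| <= B) -> vanishes_off_box r f ->
  mu.-integrable setT (EFin \o f).
Proof.
move=> mf fB fr; rewrite -(off_box fr) -restrict_EFin.
apply/(integrable_mkcond _ (measurable_box r)).
apply: (bounded_integrable (measurable_box _) (box_lty _)) => [|x _].
  exact: measurable_funTS.
exact: fB.
Qed.

Lemma vanishes_off_box_dquot r f k m : 0 <= r -> vanishes_off_box r f ->
  vanishes_off_box (r + 1) (dquot k m f).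
Proof.
move=> r0 fr x [i ri]; rewrite /dquot !fr ?subr0 ?mulr0//.
  by exists i; lra.
exists i; rewrite !mxE eqxx /=.
have : `|m.+1%:R^-1 * (i == k)%:R : R| <= 1.
  rewrite normrM ger0_norm ?invr_ge0// mulr_ile1// ?invr_ge0// ?invf_le1//.
    by rewrite ler1n.
  by case: eqP; rewrite ?normr1 ?normr0.
have := lerB_normD (x 0 i) (m.+1%:R^-1 * (i == k)%:R); lra.
Qed.

(** The difference quotients of f have integral zero because the measure is
    invariant under translation; they are uniformly bounded with support in a
    fixed box, so their limit has integral zero as well. *)
Lemma integral_partial0 k r f : tame f -> vanishes_off_box r f ->
  mu.-integrable setT (EFin \o partial k f) /\ \int[mu]_x partial k f x = 0.
Proof.
move=> tf; wlog r0 : r / 0 <= r.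
  move=> H fr; apply: (H `|r|) => // x [i ri]; apply: fr; exists i.
  by rewrite (le_lt_trans _ ri)// ler_norm.
move=> fr; have [mf [B fB] [L fL] df] := tf.
have fi : mu.-integrable setT (EFin \o f) by exact: vanishes_off_box_integrable fr.
have dq0 m : \int[mu]_x dquot k m f x = 0.
  have [fi' E] := Rintegral_shift (m.+1%:R^-1 *: 'e_k) fi.
  rewrite /dquot RintegralZl//; last first.
    by have := integrableB measurableT fi' fi; apply: eq_integrable.
  by rewrite RintegralB// E subrr mulr0.
have dqi m : mu.-integrable setT (EFin \o dquot k m f).
  by apply: vanishes_off_box_integrable (vanishes_off_box_dquot _ _ r0 fr);
    [exact: measurable_dquot | exact: dquot_le].
pose G := (cst L : 'rV[R]_n -> R) \_ (box (r + 1)).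
have Gi : mu.-integrable setT (EFin \o G).
  rewrite /G -restrict_EFin; apply/(integrable_mkcond _ (measurable_box _)).
  exact: (@bounded_integrable _ _ _ _ _ `|L| (measurable_box _) (box_lty _)).
have [] := @dominated_convergence _ _ R mu setT measurableT
  (fun m => EFin \o dquot k m f) (EFin \o partial k f) (EFin \o G).
- by move=> m; apply/measurable_EFinP; exact: measurable_dquot.
- by apply/measurable_EFinP; exact: tame_partial_measurable.
- apply: aeW => x _; apply: cvg_EFin; first by apply: nearW.
  exact: cvg_dquot.
- exact: Gi.
- apply: aeW => x m _ /=; rewrite lee_fin /G /patch.
  case: ifPn => [_|xb]; first exact: dquot_le.
  have := off_box (vanishes_off_box_dquot k m r0 fr) => /(congr1 (fun h => h x)).
  by rewrite /patch (negbTE xb) => <-; rewrite normr0.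
move=> pi _ lim0; split => //.
have E : [sequence \int[mu]_(x in setT) (EFin \o dquot k m f) x]_m%E = cst 0%E.
  apply/funext => m; have /fineK := integrable_fin_num measurableT (dqi m).
  by move=> E; apply: (etrans (esym E)); congr EFin; exact: dq0.
move: lim0; rewrite E => /cvg_lim; rewrite lim_cst// => lim0.
by rewrite /Rintegral -lim0.
Qed.

End tame_functions.

(** * Integration by parts against test functions *)

Section weak_derivatives.
Context {R : realType} {n : nat}.
Variable Omega : set 'rV[R]_n.
Local Notation mu := (@lebesgue_rV R n).
Local Notation "''e_' k" := (delta_mx 0 k : 'rV[R]_n) (at level 8, format "''e_' k").
Implicit Types (f g w : 'rV[R]_n -> R) (k : 'I_n) (x : 'rV[R]_n).

Lemma continuous_compact_support_bounded f (K : set 'rV[R]_n) :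
  continuous f -> compact K -> (forall x, ~ K x -> f x = 0) ->
  exists B : R, forall x, `|f x| <= B.
Proof.
move=> cf cK f0; have [K0|/set0P[x0 Kx0]] := eqVneq K set0.
  by exists 0 => x; rewrite f0 ?normr0// K0.
have [|c _ cm] := @EVT_max_rV R n (fun x => `|f x|) K (ex_intro _ x0 Kx0) cK.
  apply: continuous_subspaceT => x; apply: continuous_comp; first exact: cf.
  exact: norm_continuous.
exists `|f c| => x; have [Kx|nKx] := pselect (K x); last by rewrite f0// normr0.
by apply: cm; rewrite inE.
Qed.

Lemma compact_rV_vanishes_off_box f (K : set 'rV[R]_n) :
  compact K -> (forall x, ~ K x -> f x = 0) -> exists r, vanishes_off_box r f.
Proof.
move=> /compact_bounded[M [_ /(_ (M + 1))]] KM f0.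
exists (M + 1) => x [i Mi]; apply: f0 => Kx; move: Mi.
rewrite ltNge => /negP; apply; have := KM _ x Kx; rewrite ltrDl ltr01 => /(_ isT).
apply: le_trans; rewrite /Num.norm /= mx_normrE.
by rewrite (le_trans _ (le_bigmax _ _ (0, i))).
Qed.

(** Compact support makes the continuous functions f and its first derivatives
    bounded, and the Lipschitz bound follows from the mean value theorem along
    coordinate lines. *)
Lemma test_functionP f : test_function Omega f ->
  [/\ tame f, exists r, vanishes_off_box r f &
      forall x, ~ Omega x -> f x = 0 /\ forall k, partial k f x = 0].
Proof.
move=> [sf [K [cK KO f0]]].
have cf : continuous f by move=> x; apply: differentiable_continuous; exact: (sf [::]).
have df k x : derivable f x 'e_k by apply: diff_derivable; exact: (sf [::]).
have pf0 k x : ~ K x -> partial k f x = 0.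
  move=> nKx; have -> : partial k f x = 'D_('e_k) (cst 0 : 'rV[R]_n -> R) x.
    apply: near_eq_derive; have : nbhs x (~` K).
      apply: open_nbhs_nbhs; split => //; apply: closed_openC.
      by apply: compact_closed => //; exact: norm_hausdorff.
    by apply: filterS => y /f0.
  exact: derive_cst.
have cpf k : continuous (partial k f).
  by move=> x; apply: differentiable_continuous; exact: (sf [:: k]).
split; last first.
- move=> x nOx; have nKx : ~ K x by move=> /KO.
  by split => [|k]; [exact: f0|exact: pf0].
- exact: compact_rV_vanishes_off_box f0.
split => //.
- exact: continuous_measurable_fun_rV.
- exact: continuous_compact_support_bounded f0.
have /choice[L fL] : forall k, exists L : R, forall x, `|partial k f x| <= L.
  by move=> k; exact: continuous_compact_support_bounded (pf0 k).
have L0 k : 0 <= L k := le_trans (normr_ge0 _) (fL k 0).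
exists (\sum_k L k) => k x h.
have dline t : is_derive (t : R) 1 (fun s => f (x + s *: 'e_k)) (partial k f (x + t *: 'e_k)).
  have E : (fun s : R => s^-1 *: (((fun s => f (x + s *: 'e_k)) \o shift t) (s *: 1) - f (x + t *: 'e_k)))
      = (fun s : R => s^-1 *: ((f \o shift (x + t *: 'e_k)) (s *: 'e_k) - f (x + t *: 'e_k))).
    apply/funext => s /=; congr (_ *: (f _ - _)).
    by rewrite scalerDl addrCA [s *: 1]mulr1.
  by have := df k (x + t *: 'e_k); split; rewrite /derivable /derive /= ?E.
have := lipschitz_line dline (fun t => fL k _) 0 h.
rewrite scale0r addr0 subr0 => H; apply: (le_trans H).
by rewrite ler_wpM2r// (bigD1 k)//= lerDl sumr_ge0.
Qed.

(** A product of tame functions is tame, hence its partial derivatives have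
    integral zero as soon as one factor is compactly supported. *)
Lemma integration_by_parts k w f : tame w -> test_function Omega f ->
  \int[mu]_(x in Omega) (w x * partial k f x) =
  - \int[mu]_(x in Omega) (partial k w x * f x).
Proof.
move=> tw /test_functionP[tf [r fr] f0].
have twf := tameM tw tf.
have wfr : vanishes_off_box r (fun x => w x * f x) by move=> x /fr ->; rewrite mulr0.
have [_] := integral_partial0 k twf wfr.
have [[mw [B wB] _ _] [mf [B' fB] _ _]] := (tw, tf).
have [L dwL] := tame_partial_bounded k tw.
have [L' dfL] := tame_partial_bounded k tf.
have fi : mu.-integrable setT (EFin \o (fun x => partial k w x * f x)).
  apply: (@vanishes_off_box_integrable _ _ r _ (L * B')).
  - by apply: measurable_funM => //; exact: tame_partial_measurable.
  - by move=> x; rewrite normrM ler_pM.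
  - by move=> x /fr ->; rewrite mulr0.
have [pi _] := integral_partial0 k twf wfr.
have E x : w x * partial k f x = partial k (fun x => w x * f x) x - partial k w x * f x.
  by rewrite partialM//; ring.
have gi : mu.-integrable setT (EFin \o (fun x => w x * partial k f x)).
  by apply: eq_integrable (integrableB measurableT pi fi) => // x _ /=; rewrite E EFinB.
have toT g : (forall x, ~ Omega x -> g x = 0) ->
    \int[mu]_(x in Omega) g x = \int[mu]_x g x.
  move=> g0; rewrite Rintegral_mkcond; apply: eq_Rintegral => x _.
  by rewrite /patch; case: ifPn => //; rewrite notin_setE => /g0.
rewrite !toT; last 2 first.
- by move=> x /f0[-> _]; rewrite mulr0.
- by move=> x /f0[_ ->]; rewrite mulr0.
under eq_Rintegral do rewrite partialM//.
rewrite RintegralD//; last first.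
  by apply: eq_integrable fi => // x _ /=; rewrite mulrC.
under [X in _ + X]eq_Rintegral do rewrite mulrC.
by move=> /eqP; rewrite addr_eq0 => /eqP.
Qed.

End weak_derivatives.

(** * Bounded operators on square summable sequences *)

Section ell2_theory.
Context {R : realType}.
Implicit Types (u v : nat -> R[i]) (T : ell2_op R).

Definition psum2 u (N : nat) : R := \sum_(0 <= i < N) normc (u i) ^+ 2.

Lemma psum2_ge0 u N : 0 <= psum2 u N.
Proof. by apply: sumr_ge0 => i _; exact: sqr_ge0. Qed.

Lemma psum2_nd u : nondecreasing_seq (psum2 u).
Proof.
apply/nondecreasing_seqP => N; rewrite /psum2 big_nat_recr//= lerDl.
exact: sqr_ge0.
Qed.

Lemma nneseries_series_cvg (x : nat -> R) : (forall i, 0 <= x i) ->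
  (\sum_(i <oo) (x i)%:E < +oo)%E ->
  series x @ \oo --> fine (\sum_(i <oo) (x i)%:E)%E.
Proof.
move=> x0 xoo; have s0 : (0 <= \sum_(i <oo) (x i)%:E)%E.
  by apply: nneseries_ge0 => i _ _; rewrite lee_fin.
have : (EFin \o series x) @ \oo --> (fine (\sum_(i <oo) (x i)%:E)%E)%:E.
  rewrite fineK ?ge0_fin_numE// (_ : EFin \o _ = fun N => (\sum_(0 <= i < N) (x i)%:E)%E).
    by apply: is_cvg_nneseries => i _ _; rewrite lee_fin.
  by apply/funext => N; rewrite /= /series/= sumEFin.
by move/fine_cvg.
Qed.

Lemma nneseries_bounded (x : nat -> R) (B : R) : (forall i, 0 <= x i) ->
  (forall N, series x N <= B) ->
  (\sum_(i <oo) (x i)%:E < +oo)%E /\ fine (\sum_(i <oo) (x i)%:E)%E <= B.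
Proof.
move=> x0 xB; have s0 : (0 <= \sum_(i <oo) (x i)%:E)%E.
  by apply: nneseries_ge0 => i _ _; rewrite lee_fin.
have le : (\sum_(i <oo) (x i)%:E <= B%:E)%E.
  apply: lime_le; first by apply: is_cvg_nneseries => i _ _; rewrite lee_fin.
  by apply: nearW => N; rewrite sumEFin lee_fin; exact: xB.
have xoo : (\sum_(i <oo) (x i)%:E < +oo)%E by rewrite (le_lt_trans le)// ltry.
by split => //; rewrite -lee_fin fineK// ge0_fin_numE.
Qed.

Lemma ell2_cvg u : ell2 u -> psum2 u @ \oo --> fine (ell2_sq u).
Proof. by apply: nneseries_series_cvg => i; exact: sqr_ge0. Qed.

Lemma psum2_le u N : ell2 u -> psum2 u N <= fine (ell2_sq u).
Proof.
move=> /ell2_cvg uc; rewrite -(cvg_lim _ uc)//.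
by apply: nondecreasing_cvgn_le; [exact: psum2_nd|exact: cvgP uc].
Qed.

Lemma ell2_bounded u B : (forall N, psum2 u N <= B) ->
  ell2 u /\ fine (ell2_sq u) <= B.
Proof. by apply: nneseries_bounded => i; exact: sqr_ge0. Qed.

Lemma ell2_norm_sqr u : ell2 u -> ell2_norm u ^+ 2 = fine (ell2_sq u).
Proof. by move=> uoo; rewrite sqr_sqrtr// (le_trans (psum2_ge0 u 0))// psum2_le. Qed.

Lemma ell2_norm_le u B : 0 <= B -> (forall N, psum2 u N <= B ^+ 2) ->
  ell2 u /\ ell2_norm u <= B.
Proof.
move=> B0 /ell2_bounded[uoo uB]; split=> //.
by rewrite -(@ler_pXn2r _ 2)// ?nnegrE ?sqrtr_ge0// ell2_norm_sqr.
Qed.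

Lemma normc_le_ell2_norm u i : ell2 u -> normc (u i) <= ell2_norm u.
Proof.
move=> uoo; rewrite -(@ler_pXn2r _ 2)// ?nnegrE ?sqrtr_ge0 ?normc_ge0//.
rewrite ell2_norm_sqr//; apply: (le_trans _ (psum2_le i.+1 uoo)).
by rewrite /psum2 big_nat_recr//= lerDr; exact: psum2_ge0.
Qed.

Lemma normc_sqr_lincomb (a x y : R[i]) :
  normc (a * x + y) ^+ 2 <= 2 * normc a ^+ 2 * normc x ^+ 2 + 2 * normc y ^+ 2.
Proof.
rewrite -mulrA -exprMn -normcM; have := le_normcD (a * x) y.
have := normc_ge0 (a * x + y); have := normc_ge0 (a * x); have := normc_ge0 y.
move: (normc (a * x + y)) (normc (a * x)) (normc y) => p q r r0 q0 p0 pqr.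
apply: (@le_trans _ _ ((q + r) ^+ 2)); first by rewrite ler_pXn2r// nnegrE addr_ge0.
by have := sqr_ge0 (q - r); rewrite !expr2; lra.
Qed.

Lemma ell2_lincomb (a : R[i]) u v : ell2 u -> ell2 v ->
  ell2 (fun m => a * u m + v m).
Proof.
move=> uoo voo; apply: proj1 (@ell2_bounded _
  (2 * normc a ^+ 2 * fine (ell2_sq u) + 2 * fine (ell2_sq v)) _) => N.
apply: (@le_trans _ _ (2 * normc a ^+ 2 * psum2 u N + 2 * psum2 v N)).
  rewrite /psum2 !mulr_sumr -big_split; apply: ler_sum => i _.
  exact: normc_sqr_lincomb.
by apply: lerD; apply: ler_wpM2l; rewrite ?psum2_le// mulr_ge0// sqr_ge0.
Qed.

Definition trunc N u : nat -> R[i] := fun i => if (i < N)%N then u i else 0.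

Lemma normc0_sqr : normc (0 : R[i]) ^+ 2 = 0.
Proof. by rewrite normc0 expr0n. Qed.

Lemma psum2_trunc N u m : psum2 (trunc N u) m <= psum2 u N.
Proof.
have [mN|/ltnW Nm] := leqP m N.
  apply: (le_trans _ (@psum2_nd u _ _ mN)); apply: ler_sum => i _; rewrite /trunc.
  by case: ifP => // _; rewrite normc0_sqr sqr_ge0.
rewrite /psum2 (big_cat_nat (leq0n N) Nm)//= [X in _ + X]big1_seq ?addr0; last first.
  move=> i /andP[_]; rewrite mem_index_iota /trunc => /andP[Ni _].
  by rewrite ltnNge Ni /= normc0_sqr.
by apply: ler_sum_nat => i /andP[_ iN]; rewrite /trunc iN.
Qed.

Lemma ell2_trunc N u : ell2 (trunc N u).
Proof. by apply: proj1 (ell2_bounded (psum2_trunc N u)). Qed.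

Lemma ell2_cst0 : ell2 (fun=> 0 : R[i]).
Proof. have -> : (fun=> 0) = trunc 0 (fun=> 0) :> (nat -> R[i]) by apply/funext.
exact: ell2_trunc. Qed.

Lemma ell2_unitP j : ell2 (ell2_unit j : nat -> R[i]).
Proof.
have -> : ell2_unit j = trunc j.+1 (ell2_unit j) :> (nat -> R[i]).
  apply/funext => i; rewrite /trunc /ell2_unit; case: ltnP => // ji.
  by rewrite gtn_eqF.
exact: ell2_trunc.
Qed.

Lemma ell2_sub_trunc N u : ell2 u ->
  ell2 (fun m => - 1 * trunc N u m + u m) /\
  ell2_norm (fun m => - 1 * trunc N u m + u m) <=
    Num.sqrt (fine (ell2_sq u) - psum2 u N).
Proof.
move=> uoo; apply: ell2_norm_le => [|m]; first exact: sqrtr_ge0.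
rewrite sqr_sqrtr ?subr_ge0 ?psum2_le// lerBrDr.
apply: (@le_trans _ _ (psum2 u (m + N))); last exact: psum2_le.
apply: (@le_trans _ _ (psum2 (fun m => - 1 * trunc N u m + u m) (m + N) + psum2 u N)).
  by rewrite lerD2r psum2_nd// leq_addr.
rewrite /psum2 (big_cat_nat (leq0n N) (leq_addl m N))//= [X in X + _ + _]big1_seq ?add0r; last first.
  move=> i /andP[_]; rewrite mem_index_iota /trunc => /andP[_ iN].
  by rewrite iN mulN1r addNr normc0_sqr.
rewrite addrC [leRHS](big_cat_nat (leq0n N) (leq_addl m N))//= lerD2l.
apply: ler_sum_nat => i /andP[Ni _].
by rewrite /trunc ltnNge Ni /= mulr0 add0r.
Qed.

Lemma ell2_op0 T n : T (fun=> 0) n = 0.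
Proof.
have := ell2_fun_linear T (-1) ell2_cst0 ell2_cst0 n.
under [X in ell2_fun T X]eq_fun do rewrite mulr0 addr0.
by rewrite mulN1r addNr.
Qed.

Lemma ell2_opZ T (a : R[i]) u n : ell2 u -> T (fun m => a * u m) n = a * T u n.
Proof.
move=> uoo; have := ell2_fun_linear T a uoo ell2_cst0 n.
by under [X in ell2_fun T X]eq_fun do rewrite addr0; rewrite ell2_op0 addr0.
Qed.

(** A finitely supported vector is a finite combination of unit vectors, so on
    it the operator is given by its matrix. *)
Lemma ell2_op_trunc T N u n :
  T (trunc N u) n = \sum_(0 <= j < N) ell2_entry T n j * u j.
Proof.
elim: N => [|N IH]; first by rewrite big_nil -(ell2_op0 T n); congr (ell2_fun T _ n); apply/funext.
rewrite big_nat_recr//= -IH addrC mulrC /ell2_entry.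
rewrite -(ell2_fun_linear T _ (ell2_unitP N) (ell2_trunc N u)).
congr (ell2_fun T _ n); apply/funext => i; rewrite /trunc /ell2_unit ltnS leq_eqVlt.
by have [->|iN] /= := eqVneq i N; rewrite ?ltnn ?mulr1 ?addr0// mulr0 add0r.
Qed.

(** The matrix determines the operator: truncations of u converge to u in norm
    and T is bounded. *)
Lemma ell2_op_cvg T u n : ell2 u ->
  (fun N => normc (T u n - \sum_(0 <= j < N) ell2_entry T n j * u j)) @ \oo --> 0.
Proof.
move=> uoo; have [K KT] := ell2_fun_bounded T.
have c : (fun N => `|K| * Num.sqrt (fine (ell2_sq u) - psum2 u N)) @ \oo --> 0.
  rewrite -[X in _ --> X](mulr0 `|K|); apply: cvgMr; rewrite -[X in _ --> X]sqrtr0.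
  have : (fun N => fine (ell2_sq u) - psum2 u N) @ \oo --> 0.
    rewrite -[X in _ --> X](subrr (fine (ell2_sq u))).
    by apply: cvgB; [exact: cvg_cst|exact: ell2_cvg].
  by move=> /cvg_comp; apply; exact: sqrt_continuous.
apply: (squeeze_cvgr _ (cvg_cst 0) c); apply: nearW => N.
rewrite normc_ge0 /= -ell2_op_trunc; have [voo vle] := ell2_sub_trunc N uoo.
have := ell2_fun_linear T (-1) (ell2_trunc N u) uoo n.
rewrite mulN1r addrC => <-; have [Tvoo Tvle] := KT _ voo.
apply: (le_trans (normc_le_ell2_norm n Tvoo)); apply: (le_trans Tvle).
apply: (@le_trans _ _ (`|K| * ell2_norm (fun m => - 1 * trunc N u m + u m))).
  by rewrite ler_wpM2r ?sqrtr_ge0// ler_norm.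
by rewrite ler_wpM2l.
Qed.

Lemma normc_cvg (z : nat -> R[i]) (l : R[i]) :
  (fun N => normc (l - z N)) @ \oo --> 0 ->
  ((fun N => cRe (z N)) @ \oo --> cRe l) /\ ((fun N => cIm (z N)) @ \oo --> cIm l).
Proof.
move=> c; split; apply/cvgrPdist_le => e e0;
  move/cvgrPdist_le : c => /(_ e e0); apply: filterS => N;
  rewrite sub0r normrN (ger0_norm (normc_ge0 _)); apply: le_trans.
- by rewrite -cReN -cReD; exact: normr_cRe.
- by rewrite -cImN -cImD; exact: normr_cIm.
Qed.

Lemma ell2_op_series_cvg T u n : ell2 u ->
  (series (fun m => cRe (ell2_entry T n m * u m)) @ \oo --> cRe (T u n)) /\
  (series (fun m => cIm (ell2_entry T n m * u m)) @ \oo --> cIm (T u n)).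
Proof.
move=> /(ell2_op_cvg T n)/normc_cvg[a b]; split.
- by apply: cvg_trans a; apply: near_eq_cvg; apply: nearW => N; rewrite cRe_sum.
- by apply: cvg_trans b; apply: near_eq_cvg; apply: nearW => N; rewrite cIm_sum.
Qed.

Lemma cseries_ell2_op T u n : ell2 u ->
  cseries (fun m => ell2_entry T n m * u m) = T u n.
Proof.
move=> /(ell2_op_series_cvg T n)[a b]; apply: complex_ext => /=; exact: cvg_lim.
Qed.

Let has_ubound_opnorm T :
  has_ubound [set ell2_norm (T u) | u in [set u | ell2 u /\ ell2_norm u <= 1]].
Proof.
have [K KT] := ell2_fun_bounded T; exists `|K| => _ [u [uoo u1] <-].
have [_] := KT u uoo; move=> /le_trans; apply.
apply: (@le_trans _ _ (`|K| * ell2_norm u)).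
  by rewrite ler_wpM2r ?sqrtr_ge0// ler_norm.
by rewrite ler_piMr.
Qed.

Lemma ell2_normZ (a : R) u : 0 <= a -> ell2 u ->
  ell2 (fun m => a%:C%C * u m) /\ ell2_norm (fun m => a%:C%C * u m) = a * ell2_norm u.
Proof.
move=> a0 uoo; have aE m : normc (a%:C%C * u m) ^+ 2 = a ^+ 2 * normc (u m) ^+ 2.
  by rewrite normcM exprMn /= expr0n /= addr0 sqrtr_sqr real_normK ?num_real.
have pE N : psum2 (fun m => a%:C%C * u m) N = a ^+ 2 * psum2 u N.
  by rewrite /psum2 mulr_sumr; apply: eq_bigr => i _; exact: aE.
have auoo : ell2 (fun m => a%:C%C * u m).
  apply: proj1 (@ell2_bounded _ (a ^+ 2 * fine (ell2_sq u)) _) => N.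
  by rewrite pE ler_wpM2l ?sqr_ge0// psum2_le.
split => //; apply/eqP; rewrite -(@eqrXn2 _ 2)// ?mulr_ge0 ?sqrtr_ge0//.
rewrite exprMn !ell2_norm_sqr//; apply/eqP.
have := ell2_cvg auoo => /cvg_lim <-//; apply: cvg_lim => //.
rewrite (_ : psum2 _ = (fun N => a ^+ 2 * psum2 u N)); last exact/funext.
by apply: cvgMr; exact: ell2_cvg.
Qed.

(** The supremum defining the operator norm runs over the unit ball, so u is
    rescaled to norm one. *)
Lemma ell2_opnormP T u : ell2 u ->
  ell2 (T u) /\ ell2_norm (T u) <= ell2_opnorm T * ell2_norm u.
Proof.
move=> uoo; have [K KT] := ell2_fun_bounded T; have [Tuoo Tule] := KT u uoo.
split => //; have [u0|u0] := eqVneq (ell2_norm u) 0.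
  by move: Tule; rewrite u0 !mulr0.
have up : 0 < ell2_norm u by rewrite lt_def u0 sqrtr_ge0.
have i0 : 0 <= (ell2_norm u)^-1 by rewrite invr_ge0 ltW.
have [voo vE] := ell2_normZ i0 uoo.
rewrite -ler_pdivrMr// mulrC.
have [_ <-] := ell2_normZ i0 Tuoo.
apply: ub_le_sup; first exact: has_ubound_opnorm.
exists (fun m => (ell2_norm u)^-1%:C%C * u m).
  by split => //; rewrite vE mulVf.
by congr ell2_norm; apply/funext => m; rewrite ell2_opZ.
Qed.

Lemma ell2_opnorm_le T (K : R) : 0 <= K ->
  (forall u, ell2 u -> ell2_norm (T u) <= K * ell2_norm u) -> ell2_opnorm T <= K.
Proof.
move=> K0 H; apply: ge_sup.
  exists (ell2_norm (T (fun=> 0))); exists (fun=> 0) => //; split; first exact: ell2_cst0.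
  apply: proj2 (ell2_norm_le ler01 _) => N.
  by rewrite /psum2 big1 ?expr1n ?ler01// => i _; rewrite normc0_sqr.
move=> _ [u [uoo u1] <-]; apply: (le_trans (H u uoo)).
by rewrite ler_piMr.
Qed.

Lemma cvg_sum_nat (F : nat -> nat -> R) (l : nat -> R) (N : nat) :
  (forall i, (i < N)%N -> F ^~ i @ \oo --> l i) ->
  (fun m => \sum_(0 <= i < N) F m i) @ \oo --> \sum_(0 <= i < N) l i.
Proof.
elim: N => [|N IH] Fl.
  rewrite big_nil (_ : (fun m => _) = cst 0); first exact: cvg_cst.
  by apply/funext => m; rewrite big_nil.
rewrite big_nat_recr//= (_ : (fun m => _) = (fun m => \sum_(0 <= i < N) F m i + F m N)).
  by apply: cvgD; [apply: IH => i iN; apply: Fl; exact: ltnW|exact: Fl].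
by apply/funext => m; rewrite big_nat_recr.
Qed.

Lemma cvg_normc_sqr (z : nat -> R[i]) (l : R[i]) :
  (fun m => cRe (z m)) @ \oo --> cRe l -> (fun m => cIm (z m)) @ \oo --> cIm l ->
  (fun m => normc (z m) ^+ 2) @ \oo --> normc l ^+ 2.
Proof.
move=> a b; rewrite normc_sqr.
rewrite (_ : (fun m => _) = (fun m => cRe (z m) * cRe (z m) + cIm (z m) * cIm (z m))).
  by apply: cvgD; rewrite expr2; apply: cvgM.
by apply/funext => m; rewrite normc_sqr !expr2.
Qed.

(** A countable family of vectors, dense in every finite number of coordinates. *)
Definition qvec (s : seq (rat * rat)) (i : nat) : R[i] :=
  Complex (ratr (nth (0, 0) s i).1) (ratr (nth (0, 0) s i).2).

Definition sesqui (c : nat -> nat -> R[i]) u v (N : nat) : R[i] :=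
  \sum_(0 <= i < N) (\sum_(0 <= j < N) c i j * u j) * conjc (v i).

Let cRe_sesqui c u v N : cRe (sesqui c u v N) = \sum_(0 <= i < N)
  ((\sum_(0 <= j < N) (cRe (c i j) * cRe (u j) - cIm (c i j) * cIm (u j))) * cRe (v i)
  + (\sum_(0 <= j < N) (cRe (c i j) * cIm (u j) + cIm (c i j) * cRe (u j))) * cIm (v i)).
Proof.
rewrite /sesqui cRe_sum; apply: eq_bigr => i _; rewrite cReM cReJ cImJ mulrN opprK.
rewrite cRe_sum cIm_sum; congr (_ * _ + _ * _); apply: eq_bigr => j _.
  by rewrite cReM. by rewrite cImM.
Qed.

Let ratr_cvg (x : R) : exists q : nat -> rat, (fun m => ratr (q m) : R) @ \oo --> x.
Proof.
have /choice[q qx] : forall m : nat, exists q : rat, `|x - ratr q| <= harmonic m.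
  move=> m; have : x - m.+1%:R^-1 < x + m.+1%:R^-1.
    by rewrite ltrD2l gtrN// invr_gt0.
  move=> /rat_in_itvoo[q]; rewrite in_itv /= => /andP[q1 q2]; exists q.
  rewrite ler_norml /harmonic; move: q1 q2; move: (ratr q) (m.+1%:R^-1) => a b ? ?.
  by apply/andP; split; lra.
exists q; apply/cvgrPdist_le => e e0.
have /cvgr0_norm_le /(_ _ e0) := @cvg_harmonic R; apply: filterS => m.
by apply: le_trans; rewrite (le_trans (qx m))// ler_norm.
Qed.

Let qvec_cvg (N : nat) u : exists s : nat -> seq (rat * rat),
  forall i, (i < N)%N ->
    ((fun m => cRe (qvec (s m) i)) @ \oo --> cRe (u i)) /\
    ((fun m => cIm (qvec (s m) i)) @ \oo --> cIm (u i)).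
Proof.
have /choice[q qP] : forall x : R, exists q : nat -> rat, (fun m => ratr (q m) : R) @ \oo --> x.
  exact: ratr_cvg.
exists (fun m => mkseq (fun i => (q (cRe (u i)) m, q (cIm (u i)) m)) N) => i iN.
by split; under eq_fun do rewrite /qvec nth_mkseq//=; exact: qP.
Qed.

(** Only finitely many coordinates enter, and both sides are continuous in them. *)
Lemma sesqui_rat_dense (c : nat -> nat -> R[i]) (K : R) N :
  (forall s t, cRe (sesqui c (qvec s) (qvec t) N) <=
     K * (psum2 (qvec s) N + psum2 (qvec t) N)) ->
  forall u v, cRe (sesqui c u v N) <= K * (psum2 u N + psum2 v N).
Proof.
move=> H u v; have [s su] := qvec_cvg N u; have [t tv] := qvec_cvg N v.
have cp w (r : nat -> seq (rat * rat)) : (forall i, (i < N)%N ->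
    ((fun m => cRe (qvec (r m) i)) @ \oo --> cRe (w i)) /\
    ((fun m => cIm (qvec (r m) i)) @ \oo --> cIm (w i))) ->
    (fun m => psum2 (qvec (r m)) N) @ \oo --> psum2 w N.
  move=> rw; apply: cvg_sum_nat => i iN.
  by have [a b] := rw i iN; exact: cvg_normc_sqr.
have L : (fun m => K * (psum2 (qvec (s m)) N + psum2 (qvec (t m)) N)) @ \oo -->
    K * (psum2 u N + psum2 v N).
  by apply: cvgMr; apply: cvgD; exact: cp.
have S : (fun m => cRe (sesqui c (qvec (s m)) (qvec (t m)) N)) @ \oo --> cRe (sesqui c u v N).
  rewrite cRe_sesqui; under eq_fun do rewrite cRe_sesqui.
  apply: cvg_sum_nat => i iN; have [a b] := tv i iN.
  apply: cvgD; apply: cvgM => //; apply: cvg_sum_nat => j jN; have [a' b'] := su j jN.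
  - by apply: cvgB; apply: cvgMr.
  - by apply: cvgD; apply: cvgMr.
by apply: ler_cvg_to S L _; apply: nearW => m; exact: H.
Qed.

(** Let v be the first n coordinates of the image of a truncation of u. Testing u
    against v / (2 K) gives |v|^2 / (2 K) <= K |u|^2 + |v|^2 / (4 K), that is
    |v| <= 2 K |u|, and v tends to the first n coordinates of T u. *)
Lemma ell2_opnorm_sesqui_le T (K : R) : 0 < K ->
  (forall N u v, cRe (sesqui (ell2_entry T) u v N) <= K * (psum2 u N + psum2 v N)) ->
  ell2_opnorm T <= 2 * K.
Proof.
move=> K0 H; apply: ell2_opnorm_le; first by rewrite mulr_ge0// ltW.
move=> u uoo; apply: proj2 (ell2_norm_le _ _) => [|n].
  by rewrite !mulr_ge0 ?sqrtr_ge0// ltW.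
rewrite exprMn ell2_norm_sqr//.
pose v N i := \sum_(0 <= j < N) ell2_entry T i j * u j.
have c : (fun N => psum2 (v N) n) @ \oo --> psum2 (T u) n.
  apply: cvg_sum_nat => i _; have /normc_cvg[a b] := ell2_op_cvg T i uoo.
  exact: cvg_normc_sqr.
rewrite -(cvg_lim _ c)//; apply: limr_le; first exact: cvgP c.
near=> N; have nN : (n <= N)%N by near: N; exact: nbhs_infty_ge.
pose a := (2 * K)^-1; have a0 : 0 < a by rewrite invr_gt0 mulr_gt0.
pose w i : R[i] := a%:C%C * trunc n (v N) i.
have aE z : normc (a%:C%C * z) ^+ 2 = a ^+ 2 * normc z ^+ 2.
  by rewrite normcM exprMn /= expr0n /= addr0 sqrtr_sqr real_normK ?num_real.
have Pw : psum2 w N <= a ^+ 2 * psum2 (v N) n.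
  apply: (@le_trans _ _ (a ^+ 2 * psum2 (trunc n (v N)) N)).
    by rewrite /psum2 mulr_sumr; apply: ler_sum => i _; rewrite aE.
  by rewrite ler_wpM2l ?sqr_ge0// psum2_trunc.
have Sw : cRe (sesqui (ell2_entry T) u w N) = a * psum2 (v N) n.
  rewrite /sesqui cRe_sum (big_cat_nat (leq0n n) nN)//= [X in _ + X]big1_seq ?addr0; last first.
    move=> i /andP[_]; rewrite mem_index_iota /w /trunc => /andP[ni _].
    have -> : (i < n)%N = false by rewrite ltnNge ni.
    by rewrite !cE /=; ring.
  rewrite /psum2 mulr_sumr; apply: eq_big_nat => i /andP[_ ni].
  by rewrite -/(v N i) /w /trunc ni normc_sqr !cE /=; ring.
have := H N u w; rewrite Sw => Hs.
have {}Hs : a * psum2 (v N) n <= K * (fine (ell2_sq u) + a ^+ 2 * psum2 (v N) n).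
  apply: (le_trans Hs); rewrite ler_wpM2l ?(ltW K0)// lerD//.
  exact: psum2_le.
have aK : a * K = 1 / 2 by rewrite /a; field; rewrite gt_eqF.
have E : K * (fine (ell2_sq u) + a ^+ 2 * psum2 (v N) n) =
    K * fine (ell2_sq u) + (a * K) * (a * psum2 (v N) n) by ring.
rewrite E aK in Hs; rewrite -(ler_pM2l a0).
have -> : a * ((2 * K) ^+ 2 * fine (ell2_sq u)) = (a * K) * (4 * (K * fine (ell2_sq u))).
  by ring.
by rewrite aK; lra.
Unshelve. all: by end_near. Qed.

End ell2_theory.

(** * Square integrable sequences of functions *)

Section hilbert_sum.
Context {R : realType} {d : nat}.
Variable Omega : set 'rV[R]_d.
Hypothesis mOmega : measurable Omega.
Local Notation mu := (@lebesgue_rV R d).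
Local Notation cfun := ('rV[R]_d -> R[i]).
Implicit Types (f g h : cfun) (F G : nat -> cfun).

Definition cmeasurable f : Prop :=
  measurable_fun Omega (fun x => cRe (f x)) /\ measurable_fun Omega (fun x => cIm (f x)).

Definition aeq f g : Prop := {ae mu, forall x, Omega x -> f x = g x}.

Lemma aeqM f f' g g' : aeq f f' -> aeq g g' ->
  aeq (fun x => f x * g x) (fun x => f' x * g' x).
Proof. by move=> a b; apply: filterS2 a b => x + + Ox => -> // ->. Qed.

Lemma aeqJ f f' : aeq f f' -> aeq (fun x => conjc (f x)) (fun x => conjc (f' x)).
Proof. by apply: filterS => x + Ox => ->. Qed.

Lemma cintegral_aeq f g : aeq f g -> cintegral Omega f = cintegral Omega g.
Proof.
move=> fg; rewrite /cintegral; congr Complex; apply: ae_eq_Rintegral;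
  by apply: filterS fg => x + Ox => ->.
Qed.

Lemma L2_sq_ge0 f : (0 <= L2_sq Omega f)%E.
Proof. by apply: integral_ge0 => x _; rewrite lee_fin sqr_ge0. Qed.

Lemma L2_sq_aeq f g : aeq f g -> L2_sq Omega f = L2_sq Omega g.
Proof.
move=> fg; apply: ge0_ae_eq_integral_nonmeasurable; last first.
- by apply: filterS fg => x + Ox => ->.
- by move=> x _; rewrite lee_fin sqr_ge0.
- by move=> x _; rewrite lee_fin sqr_ge0.
Qed.

Lemma lebesgue_measurableP f :
  lebesgue_measurable Omega f <-> exists g, cmeasurable g /\ aeq f g.
Proof. by split => [[g [a b c]]|[g [[a b] c]]]; exists g. Qed.

Lemma cmeasurableM f g : cmeasurable f -> cmeasurable g ->
  cmeasurable (fun x => f x * g x).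
Proof.
move=> [a b] [a' b']; split; under eq_fun do rewrite !cE.
  by apply: measurable_funB; apply: measurable_funM.
by apply: measurable_funD; apply: measurable_funM.
Qed.

Lemma cmeasurableJ f : cmeasurable f -> cmeasurable (fun x => conjc (f x)).
Proof.
move=> [a b]; split.
  by rewrite (_ : (fun x => _) = fun x => cRe (f x))//; apply/funext => x; rewrite cReJ.
rewrite (_ : (fun x => _) = -%R \o (fun x => cIm (f x))); last first.
  by apply/funext => x; rewrite /= cImJ.
exact: measurableT_comp.
Qed.

Lemma cmeasurable_cst (c : R[i]) : cmeasurable (cst c).
Proof. by split; exact: measurable_cst. Qed.

Lemma cmeasurableD f g : cmeasurable f -> cmeasurable g ->
  cmeasurable (fun x => f x + g x).
Proof.
by move=> [a b] [a' b']; split; under eq_fun do rewrite !cE; exact: measurable_funD.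
Qed.

Lemma cmeasurable_sum (F : nat -> cfun) N : (forall i, cmeasurable (F i)) ->
  cmeasurable (fun x => \sum_(0 <= i < N) F i x).
Proof.
move=> mF; elim: N => [|N IH].
  by under eq_fun do rewrite big_nil; exact: cmeasurable_cst.
by under eq_fun do rewrite big_nat_recr//=; exact: cmeasurableD.
Qed.

Lemma measurable_normc_sqr f : cmeasurable f ->
  measurable_fun Omega (fun x => normc (f x) ^+ 2).
Proof.
move=> [a b]; under eq_fun do rewrite normc_sqr.
by apply: measurable_funD; apply: measurable_funX.
Qed.

Lemma measurable_normc_sqrE f : cmeasurable f ->
  measurable_fun Omega (fun x => (normc (f x) ^+ 2)%:E).
Proof. by move=> mf; apply/measurable_EFinP; exact: measurable_normc_sqr. Qed.

(** Elements of L^2 are only almost everywhere equal to Borel functions; working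
    with such a Borel representative gives access to the integration theorems. *)
Lemma in_L2P f : in_L2 Omega f <->
  exists g, [/\ cmeasurable g, aeq f g & (L2_sq Omega g < +oo)%E].
Proof.
split => [[/lebesgue_measurableP[g [mg fg]] foo]|[g [mg fg goo]]].
  by exists g; split => //; rewrite -(L2_sq_aeq fg).
by split; [apply/lebesgue_measurableP; exists g|rewrite (L2_sq_aeq fg)].
Qed.

Lemma L2_integrable f : cmeasurable f -> (L2_sq Omega f < +oo)%E ->
  mu.-integrable Omega (EFin \o (fun x => normc (f x) ^+ 2)).
Proof.
move=> mf foo; apply/integrableP; split; first exact: measurable_normc_sqrE.
rewrite (eq_integral (fun x => (normc (f x) ^+ 2)%:E))// => x _ /=.
by rewrite ger0_norm ?sqr_ge0.
Qed.

Definition L2_sqR f : R := fine (L2_sq Omega f).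

Lemma L2_sqR_ge0 f : 0 <= L2_sqR f.
Proof. by rewrite fine_ge0// L2_sq_ge0. Qed.

(** The products of two square integrable functions are dominated by the sum of
    their squares, with a weight t kept free for later optimisation. *)
Lemma normc_mul_le (t : R) (z w : R[i]) : 0 < t ->
  normc (z * conjc w) <= t * normc z ^+ 2 + t^-1 * normc w ^+ 2.
Proof.
move=> t0; rewrite normcM; have -> : normc (conjc w) = normc w.
  by case: w => a b /=; rewrite sqrrN.
have := normc_ge0 z; have := normc_ge0 w; move: (normc z) (normc w) => p q q0 p0.
have tt : t * t^-1 = 1 by rewrite mulfV// gt_eqF.
have : 0 <= t * (p - t^-1 * q) ^+ 2 by rewrite mulr_ge0 ?sqr_ge0// ltW.
have -> : t * (p - t^-1 * q) ^+ 2 = t * p ^+ 2 - 2 * (t * t^-1) * (p * q) + (t * t^-1) * t^-1 * q ^+ 2 by ring.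
rewrite tt mul1r mulr1; have : 0 <= p * q by rewrite mulr_ge0.
by lra.
Qed.

Definition cintegrable f :=
  mu.-integrable Omega (EFin \o (fun x => cRe (f x))) /\
  mu.-integrable Omega (EFin \o (fun x => cIm (f x))).

Lemma cintegrable_mul f g : cmeasurable f -> cmeasurable g ->
  (L2_sq Omega f < +oo)%E -> (L2_sq Omega g < +oo)%E ->
  cintegrable (fun x => f x * conjc (g x)).
Proof.
move=> mf mg foo goo.
have [mr mi] := cmeasurableM mf (cmeasurableJ mg).
have di : mu.-integrable Omega (EFin \o (fun x => normc (f x) ^+ 2 + normc (g x) ^+ 2)).
  exact: (integrableD mOmega (L2_integrable mf foo) (L2_integrable mg goo)).
have D x : normc (f x * conjc (g x)) <= `|normc (f x) ^+ 2 + normc (g x) ^+ 2|.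
  rewrite ger0_norm ?addr_ge0 ?sqr_ge0//.
  by have := @normc_mul_le 1 (f x) (g x) ltr01; rewrite invr1 !mul1r.
by split; apply: le_integrable di => //; [exact/measurable_EFinP| |exact/measurable_EFinP|];
  move=> x _ /=; rewrite lee_fin; apply: le_trans (D x); [exact: normr_cRe|exact: normr_cIm].
Qed.

(** Cauchy-Schwarz with a free weight t, for the coordinates of the product. *)
Lemma cintegral_mul_le (t : R) f g : 0 < t -> cmeasurable f -> cmeasurable g ->
  (L2_sq Omega f < +oo)%E -> (L2_sq Omega g < +oo)%E ->
  `|cRe (cintegral Omega (fun x => f x * conjc (g x)))| <= t * L2_sqR f + t^-1 * L2_sqR g /\
  `|cIm (cintegral Omega (fun x => f x * conjc (g x)))| <= t * L2_sqR f + t^-1 * L2_sqR g.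
Proof.
move=> t0 mf mg foo goo; have [ri ii] := cintegrable_mul mf mg foo goo.
have fi := L2_integrable mf foo; have gi := L2_integrable mg goo.
have fi' : mu.-integrable Omega (EFin \o (fun x => t * normc (f x) ^+ 2)).
  by have := integrableZl mOmega t fi; apply: eq_integrable.
have gi' : mu.-integrable Omega (EFin \o (fun x => t^-1 * normc (g x) ^+ 2)).
  by have := integrableZl mOmega t^-1 gi; apply: eq_integrable.
have di : mu.-integrable Omega
    (EFin \o (fun x => t * normc (f x) ^+ 2 + t^-1 * normc (g x) ^+ 2)).
  exact: (integrableD mOmega fi' gi').
have -> : t * L2_sqR f + t^-1 * L2_sqR g =
    \int[mu]_(x in Omega) (t * normc (f x) ^+ 2 + t^-1 * normc (g x) ^+ 2).
  by rewrite RintegralD// !RintegralZl.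
split; rewrite /cintegral /=.
- apply: (le_trans (le_normr_Rintegral mOmega ri)); apply: le_Rintegral => //.
    exact: integrable_norm.
  move=> x _; apply: (le_trans (normr_cRe _)); exact: normc_mul_le.
- apply: (le_trans (le_normr_Rintegral mOmega ii)); apply: le_Rintegral => //.
    exact: integrable_norm.
  move=> x _; apply: (le_trans (normr_cIm _)); exact: normc_mul_le.
Qed.

Lemma cintegral_lin (a : R[i]) f g : cintegrable f -> cintegrable g ->
  cintegral Omega (fun x => a * f x + g x) = a * cintegral Omega f + cintegral Omega g.
Proof.
move=> [fr fi] [gr gi].
have Z (c : R) (k : 'rV[R]_d -> R) : mu.-integrable Omega (EFin \o k) ->
    mu.-integrable Omega (EFin \o (fun x => c * k x)).
  by move=> ki; have := integrableZl mOmega c ki; apply: eq_integrable.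
have B (k l : 'rV[R]_d -> R) : mu.-integrable Omega (EFin \o k) ->
    mu.-integrable Omega (EFin \o l) -> mu.-integrable Omega (EFin \o (fun x => k x - l x)).
  by move=> ki li; have := integrableB mOmega ki li; apply: eq_integrable.
have D (k l : 'rV[R]_d -> R) : mu.-integrable Omega (EFin \o k) ->
    mu.-integrable Omega (EFin \o l) -> mu.-integrable Omega (EFin \o (fun x => k x + l x)).
  by move=> ki li; have := integrableD mOmega ki li; apply: eq_integrable.
apply: complex_ext; rewrite !cE /cintegral /=.
- under eq_Rintegral do rewrite !cE.
  rewrite RintegralD//; last by apply: B; exact: Z.
  by rewrite RintegralB ?RintegralZl//; exact: Z.
- under eq_Rintegral do rewrite !cE.
  rewrite RintegralD//; last by apply: D; exact: Z.
  by rewrite RintegralD ?RintegralZl//; exact: Z.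
Qed.

Definition H_sq F : \bar R := (\sum_(i <oo) L2_sq Omega (F i))%E.

Lemma H_sqE F : (forall i, (L2_sq Omega (F i) < +oo)%E) ->
  H_sq F = (\sum_(i <oo) (L2_sqR (F i))%:E)%E.
Proof.
move=> Foo; apply: eq_eseriesr => i _.
by rewrite fineK// ge0_fin_numE ?L2_sq_ge0.
Qed.

Lemma H_sq_aeq F G : (forall i, aeq (F i) (G i)) -> H_sq F = H_sq G.
Proof. by move=> FG; apply: eq_eseriesr => i _; exact: L2_sq_aeq. Qed.

Lemma H_sq_ge0 F : (0 <= H_sq F)%E.
Proof. by apply: nneseries_ge0 => i _ _; exact: L2_sq_ge0. Qed.

Definition borelH F : Prop := [/\ forall i, cmeasurable (F i),
  forall i, (L2_sq Omega (F i) < +oo)%E & (H_sq F < +oo)%E].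

Lemma in_H_borelP F : in_H Omega F <-> exists G, borelH G /\ forall i, aeq (F i) (G i).
Proof.
split => [[FL Foo]|[G [[mG Goo GH] FG]]].
  have /choice[G GP] : forall i, exists g, [/\ cmeasurable g, aeq (F i) g & (L2_sq Omega g < +oo)%E].
    by move=> i; apply/in_L2P.
  exists G; split => [|i]; last by have [] := GP i.
  split => [i|i|]; try by have [] := GP i.
  by rewrite -(@H_sq_aeq F)// => i; have [] := GP i.
split; last by rewrite -/(H_sq F) (H_sq_aeq FG).
by move=> i; apply/in_L2P; exists (G i).
Qed.

Lemma inner_H_aeq F F' G G' : (forall i, aeq (F i) (F' i)) -> (forall i, aeq (G i) (G' i)) ->
  inner_H Omega F G = inner_H Omega F' G'.
Proof.
move=> FF GG; rewrite /inner_H; congr cseries; apply/funext => i.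
by apply: cintegral_aeq; apply: aeqM => //; exact: aeqJ.
Qed.

Lemma borelH_series F : borelH F -> series (fun i => L2_sqR (F i)) @ \oo --> fine (H_sq F).
Proof.
move=> [_ Foo FH]; rewrite H_sqE//; apply: nneseries_series_cvg.
  by move=> i; exact: L2_sqR_ge0.
by rewrite -H_sqE.
Qed.

Let inner_term F G i := cintegral Omega (fun x => F i x * conjc (G i x)).

Let inner_bound (t : R) F G : 0 < t -> borelH F -> borelH G ->
  series (fun i => t * L2_sqR (F i) + t^-1 * L2_sqR (G i)) @ \oo -->
    t * fine (H_sq F) + t^-1 * fine (H_sq G).
Proof.
move=> t0 bF bG.
rewrite (_ : series _ = fun N => t * series (fun i => L2_sqR (F i)) N + t^-1 * series (fun i => L2_sqR (G i)) N).
  by apply: cvgD; apply: cvgMr; exact: borelH_series.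
by apply/funext => N; rewrite /series /= big_split /= !mulr_sumr.
Qed.

(** A cseries is a limit that means nothing unless the coordinate series
    converge, so convergence is established along with the bound. *)
Let dominated_series (x b : nat -> R) (l : R) : (forall i, `|x i| <= b i) ->
  series b @ \oo --> l -> cvgn (series x) /\ `|limn (series x)| <= l.
Proof.
move=> xb bl; have nc : cvgn [normed series x].
  apply: (@series_le_cvg _ _ b) => [i|i|i|].
  - exact: normr_ge0.
  - exact: le_trans (normr_ge0 _) (xb i).
  - exact: xb.
  - exact: cvgP bl.
split; first exact: normed_cvg.
apply: (le_trans (lim_series_norm nc)); rewrite -(cvg_lim _ bl)//.
apply: ler_lim; [exact: nc|exact: cvgP bl|apply: nearW => N].
by rewrite /series /=; apply: ler_sum => i _; exact: xb.
Qed.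

Let inner_cvg (t : R) F G : 0 < t -> borelH F -> borelH G ->
  [/\ cvgn (series (fun i => cRe (inner_term F G i))),
      cvgn (series (fun i => cIm (inner_term F G i))),
      `|limn (series (fun i => cRe (inner_term F G i)))| <=
        t * fine (H_sq F) + t^-1 * fine (H_sq G) &
      `|limn (series (fun i => cIm (inner_term F G i)))| <=
        t * fine (H_sq F) + t^-1 * fine (H_sq G)].
Proof.
move=> t0 bF bG; have [mF Foo _] := bF; have [mG Goo _] := bG.
have B := inner_bound t0 bF bG.
have T i := cintegral_mul_le t0 (mF i) (mG i) (Foo i) (Goo i).
have [c1 l1] := dominated_series (fun i => proj1 (T i)) B.
have [c2 l2] := dominated_series (fun i => proj2 (T i)) B.
exact: And4 c1 c2 l1 l2.
Qed.

(** Cauchy-Schwarz in the weighted form: the bound for each index can be summed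
    over the indices as it stands, t being chosen at the very end. *)
Lemma inner_H_le (t : R) F G : 0 < t -> in_H Omega F -> in_H Omega G ->
  normc (inner_H Omega F G) <= 2 * (t * fine (H_sq F) + t^-1 * fine (H_sq G)).
Proof.
move=> t0 /in_H_borelP[F' [bF FF]] /in_H_borelP[G' [bG GG]].
rewrite (inner_H_aeq FF GG) (H_sq_aeq FF) (H_sq_aeq GG).
have [_ _ l1 l2] := inner_cvg t0 bF bG.
apply: (le_trans (normc_le_ReIm _)); rewrite mulrDl mul1r.
exact: (lerD l1 l2).
Qed.

Lemma cseries_lin (a : R[i]) (u v : nat -> R[i]) :
  cvgn (series (fun i => cRe (u i))) -> cvgn (series (fun i => cIm (u i))) ->
  cvgn (series (fun i => cRe (v i))) -> cvgn (series (fun i => cIm (v i))) ->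
  cseries (fun i => a * u i + v i) = a * cseries u + cseries v.
Proof.
move=> ur ui vr vi; apply: complex_ext; rewrite !cE /cseries /=; apply: cvg_lim => //.
- rewrite (_ : series _ = fun N => cRe a * series (fun i => cRe (u i)) N
    - cIm a * series (fun i => cIm (u i)) N + series (fun i => cRe (v i)) N).
    by apply: cvgD => //; apply: cvgB; apply: cvgMr.
  apply/funext => N; rewrite /series /= !mulr_sumr -sumrB -big_split.
  by apply: eq_bigr => i _; rewrite !cE.
- rewrite (_ : series _ = fun N => cRe a * series (fun i => cIm (u i)) N
    + cIm a * series (fun i => cRe (u i)) N + series (fun i => cIm (v i)) N).
    by apply: cvgD => //; apply: cvgD; apply: cvgMr.
  apply/funext => N; rewrite /series /= !mulr_sumr -!big_split.
  by apply: eq_bigr => i _; rewrite !cE.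
Qed.

Lemma inner_H_linl (a : R[i]) F F' G : in_H Omega F -> in_H Omega F' -> in_H Omega G ->
  inner_H Omega (fun i x => a * F i x + F' i x) G =
  a * inner_H Omega F G + inner_H Omega F' G.
Proof.
move=> /in_H_borelP[f [bf Ff]] /in_H_borelP[f' [bf' Ff']] /in_H_borelP[g [bg Gg]].
rewrite (inner_H_aeq Ff Gg) (inner_H_aeq Ff' Gg).
rewrite (@inner_H_aeq _ (fun i x => a * f i x + f' i x) G g)//; last first.
  by move=> i; apply: filterS2 (Ff i) (Ff' i) => x + + Ox => -> // ->.
have [c1 c2 _ _] := inner_cvg ltr01 bf bg.
have [c1' c2' _ _] := inner_cvg ltr01 bf' bg.
transitivity (cseries (fun i => a * inner_term f g i + inner_term f' g i)); last first.
  exact: (@cseries_lin a (inner_term f g) (inner_term f' g) c1 c2 c1' c2').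
rewrite /inner_H; congr cseries; apply/funext => i; rewrite /inner_term.
have [mf foo _] := bf; have [mf' foo' _] := bf'; have [mg goo _] := bg.
rewrite -cintegral_lin; [|exact: cintegrable_mul|exact: cintegrable_mul].
by congr cintegral; apply/funext => x; rewrite mulrDl mulrA.
Qed.

Lemma inner_H_linr (a : R[i]) F G G' : in_H Omega F -> in_H Omega G -> in_H Omega G' ->
  inner_H Omega F (fun i x => a * G i x + G' i x) =
  conjc a * inner_H Omega F G + inner_H Omega F G'.
Proof.
move=> /in_H_borelP[f [bf Ff]] /in_H_borelP[g [bg Gg]] /in_H_borelP[g' [bg' Gg']].
rewrite (inner_H_aeq Ff Gg) (inner_H_aeq Ff Gg').
rewrite (@inner_H_aeq F f _ (fun i x => a * g i x + g' i x))//; last first.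
  by move=> i; apply: filterS2 (Gg i) (Gg' i) => x + + Ox => -> // ->.
have [c1 c2 _ _] := inner_cvg ltr01 bf bg.
have [c1' c2' _ _] := inner_cvg ltr01 bf bg'.
transitivity (cseries (fun i => conjc a * inner_term f g i + inner_term f g' i)); last first.
  exact: (@cseries_lin (conjc a) (inner_term f g) (inner_term f g') c1 c2 c1' c2').
rewrite /inner_H; congr cseries; apply/funext => i; rewrite /inner_term.
have [mf foo _] := bf; have [mg goo _] := bg; have [mg' goo' _] := bg'.
rewrite -cintegral_lin; [|exact: cintegrable_mul|exact: cintegrable_mul].
by congr cintegral; apply/funext => x; apply: complex_ext; rewrite !cE; ring.
Qed.

End hilbert_sum.

(** * Bounded families give continuous forms *)

Section multiplication.
Context {R : realType} {d : nat}.
Variable Omega : set 'rV[R]_d.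
Hypothesis mOmega : measurable Omega.
Local Notation mu := (@lebesgue_rV R d).
Local Notation cfun := ('rV[R]_d -> R[i]).
Implicit Types (F G : nat -> cfun).
Local Notation in_H := (in_H Omega).
Local Notation H_sq := (H_sq Omega).

Lemma integral_ell2_sq G : (forall i, cmeasurable Omega (G i)) ->
  measurable_fun Omega (fun x => ell2_sq (G ^~ x)) /\
  (\int[mu]_(x in Omega) ell2_sq (G ^~ x) = H_sq G)%E.
Proof.
move=> mG; split.
  have := @ge0_emeasurable_sum _ _ R Omega (fun i x => (normc (G i x) ^+ 2)%:E) xpredT.
  apply => [i x _ _|i _]; first by rewrite lee_fin sqr_ge0.
  exact: measurable_normc_sqrE.
apply: integral_nneseries => // [i|i x _]; first exact: measurable_normc_sqrE.
by rewrite lee_fin sqr_ge0.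
Qed.

Lemma ell2_sq_ge0 (u : nat -> R[i]) : (0 <= ell2_sq u)%E.
Proof. by apply: nneseries_ge0 => i _ _; rewrite lee_fin sqr_ge0. Qed.

(** Tonelli: the pointwise square sums have a finite integral, hence are finite
    almost everywhere. *)
Lemma in_H_ae_ell2 F : in_H F -> {ae mu, forall x, Omega x -> ell2 (F ^~ x)}.
Proof.
move=> /in_H_borelP[G [[mG Goo GH] FG]]; have [mS IS] := integral_ell2_sq mG.
have /(integrable_ae mOmega) : mu.-integrable Omega (fun x => ell2_sq (G ^~ x)).
  apply/integrableP; split => //; under eq_integral do rewrite gee0_abs ?ell2_sq_ge0//.
  by rewrite IS.
have /ae_foralln : forall i, {ae mu, forall x, Omega x -> F i x = G i x} := FG.
apply: filterS2 => x FGx + Ox => /(_ Ox).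
have -> : F ^~ x = G ^~ x by apply/funext => i; exact: FGx.
by rewrite ge0_fin_numE// ell2_sq_ge0.
Qed.

Lemma L2_sq_le_H_sq F i : (L2_sq Omega (F i) <= H_sq F)%E.
Proof.
have F0 j : (0 <= L2_sq Omega (F j))%E by exact: L2_sq_ge0.
apply: (@le_trans _ _ (\sum_(0 <= j < i.+1) L2_sq Omega (F j))%E).
  by rewrite big_nat_recr//= leeDr// sume_ge0.
exact: nneseries_lim_ge.
Qed.

Lemma fine_limn_esup (u : nat -> R) (l : R) :
  u @ \oo --> l -> fine (limn_esup (EFin \o u)) = l.
Proof.
move=> ul; have : (EFin \o u) @ \oo --> l%:E.
  by apply: cvg_EFin => //; exact: nearW.
by move=> /cvg_limn_einf_sup[_ ->].
Qed.

Variable C : 'rV[R]_d -> ell2_op R.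
Hypothesis mC : componentwise_measurable Omega C.
Variable M : R.
Hypothesis M0 : 0 <= M.
Hypothesis CM : {ae mu, forall x, Omega x -> ell2_opnorm (C x) <= M}.

Lemma mult_opE F x n : ell2 (F ^~ x) -> mult_op C F n x = C x (F ^~ x) n.
Proof. by move=> Fx; rewrite /mult_op cseries_ell2_op. Qed.

Lemma mult_op_lincomb_ae (a : R[i]) F G : in_H F -> in_H G -> forall n,
  aeq Omega (mult_op C (fun i x => a * F i x + G i x) n)
            (fun x => a * mult_op C F n x + mult_op C G n x).
Proof.
move=> /in_H_ae_ell2 hF /in_H_ae_ell2 hG n; apply: filterS2 hF hG => x + + Ox.
move=> /(_ Ox) hF /(_ Ox) hG; rewrite !mult_opE//; last exact: ell2_lincomb.
exact: ell2_fun_linear.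
Qed.

(** There are countably many entries, so a single null set serves all of them. *)
Lemma mult_op_entries : exists c : nat -> nat -> cfun,
  (forall i j, cmeasurable Omega (c i j)) /\
  {ae mu, forall x, Omega x -> forall i j, ell2_entry (C x) i j = c i j x}.
Proof.
have /choice[c cP] : forall p : nat * nat, exists g, cmeasurable Omega g /\
    aeq Omega (fun x => ell2_entry (C x) p.1 p.2) g.
  by move=> p; apply/lebesgue_measurableP; exact: mC.
exists (fun i j => c (i, j)); split => [i j|]; first by have [] := cP (i, j).
have /ae_foralln : forall i, {ae mu, forall x, forall j, Omega x ->
    ell2_entry (C x) i j = c (i, j) x}.
  by move=> i; apply: ae_foralln => j; have [_] := cP (i, j).
by apply: filterS => x H Ox i j; exact: H.
Qed.

(** Pointwise the operator norm bounds the square sum of the image; integrating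
    gives the bound on the direct sum. Each component of the image is measurable
    as the limit of the partial sums that define it. *)
Lemma mult_op_bounded F : in_H F ->
  in_H (mult_op C F) /\ fine (H_sq (mult_op C F)) <= M ^+ 2 * fine (H_sq F).
Proof.
move=> hF; have Fl2 := in_H_ae_ell2 hF.
have /in_H_borelP[G [[mG Goo GH] FG]] := hF.
have [c [mc Cc]] := mult_op_entries.
have /ae_foralln FG' : forall i, {ae mu, forall x, Omega x -> F i x = G i x} := FG.
have good : {ae mu, forall x, Omega x -> [/\ ell2_opnorm (C x) <= M,
    forall i j, ell2_entry (C x) i j = c i j x, F ^~ x = G ^~ x & ell2 (F ^~ x)]}.
  apply: filterS2 (filterI CM Cc) (filterI Fl2 FG') => x [a b] [e f] Ox.
  by split; [exact: a|exact: b|apply/funext => i; exact: f|exact: e].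
pose P n N x := \sum_(0 <= m < N) c n m x * G m x.
have mP n N : cmeasurable Omega (P n N).
  by apply: cmeasurable_sum => m; exact: cmeasurableM.
(* The upper limit of measurable functions is measurable, convergent or not;
   almost everywhere it is the limit of the partial sums. *)
pose h n : cfun := fun x => Complex (fine (limn_esup (fun N => (cRe (P n N x))%:E)))
                                    (fine (limn_esup (fun N => (cIm (P n N x))%:E))).
have mh n : cmeasurable Omega (h n).
  split => /=.
  - apply: (measurableT_comp (@fine_measurable R setT measurableT)).
    apply: (@measurable_fun_limn_esup _ _ R Omega (fun N x => (cRe (P n N x))%:E)) => N.
    by apply/measurable_EFinP; have [] := mP n N.
  - apply: (measurableT_comp (@fine_measurable R setT measurableT)).
    apply: (@measurable_fun_limn_esup _ _ R Omega (fun N x => (cIm (P n N x))%:E)) => N.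
    by apply/measurable_EFinP; have [] := mP n N.
have Ch : {ae mu, forall x, Omega x -> forall n, mult_op C F n x = h n x}.
  apply: filterS good => x + Ox n => /(_ Ox)[_ xc FGx Fx].
  have [a b] := ell2_op_series_cvg (C x) n Fx.
  have E N : P n N x = \sum_(0 <= m < N) ell2_entry (C x) n m * F m x.
    apply: eq_bigr => m _; rewrite xc; congr (_ * _).
    by have := congr1 (fun u => u m) FGx.
  rewrite mult_opE//; apply: complex_ext => /=.
  - rewrite (_ : (fun N => _) = EFin \o series (fun m => cRe (ell2_entry (C x) n m * F m x))).
      exact/esym/fine_limn_esup.
    by apply/funext => N; rewrite E cRe_sum.
  - rewrite (_ : (fun N => _) = EFin \o series (fun m => cIm (ell2_entry (C x) n m * F m x))).
      exact/esym/fine_limn_esup.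
    by apply/funext => N; rewrite E cIm_sum.
have Ch' n : aeq Omega (mult_op C F n) (h n).
  by apply: filterS Ch => x H Ox; exact: H.
have [mSh ISh] := integral_ell2_sq mh; have [mSG ISG] := integral_ell2_sq mG.
have hG : (H_sq h <= (M ^+ 2)%:E * H_sq G)%E.
  rewrite -ISh -ISG -ge0_integralZl_EFin ?sqr_ge0//; last first.
    by move=> x _; exact: ell2_sq_ge0.
  apply: ae_ge0_le_integral => //.
  - by move=> x _; exact: ell2_sq_ge0.
  - by move=> x _; rewrite mule_ge0 ?lee_fin ?sqr_ge0 ?ell2_sq_ge0.
  - exact: measurable_funeM.
  - apply: filterS2 good Ch => x + + Ox => /(_ Ox)[oM xc FGx Fx] /(_ Ox) hx.
    have -> : h ^~ x = C x (F ^~ x).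
      by apply/funext => n; rewrite -hx mult_opE.
    rewrite -FGx; have [Cx Cle] := ell2_opnormP (C x) Fx.
    have fin u : ell2 u -> ell2_sq u = (ell2_norm u ^+ 2)%:E :> \bar R.
      by move=> ul; rewrite ell2_norm_sqr// fineK// ge0_fin_numE// ell2_sq_ge0.
    rewrite !fin// -EFinM lee_fin -exprMn ler_pXn2r// ?nnegrE ?mulr_ge0 ?sqrtr_ge0//.
    by apply: (le_trans Cle); rewrite ler_wpM2r// sqrtr_ge0.
have hoo : (H_sq h < +oo)%E.
  by apply: (le_lt_trans hG); rewrite lte_mul_pinfty// lee_fin sqr_ge0.
split.
  apply/in_H_borelP; exists h; split => //; split => // i.
  exact: le_lt_trans (L2_sq_le_H_sq _ _) hoo.
rewrite (H_sq_aeq Ch') (H_sq_aeq FG) -lee_fin EFinM !fineK// ge0_fin_numE//;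
  exact: H_sq_ge0.
Qed.

Local Notation in_V := (in_V Omega).

Lemma in_V_grad (psi : Vfun) k : in_V psi -> in_H (Vgrad psi k) /\
  fine (H_sq (Vgrad psi k)) <= fine (V_sq Omega psi).
Proof.
move=> [h1 Voo].
have V0 i : (0 <= H1_sq Omega (Vval psi i) (fun k => Vgrad psi k i))%E.
  by rewrite adde_ge0 ?L2_sq_ge0// sume_ge0// => j _; exact: L2_sq_ge0.
have le : (H_sq (Vgrad psi k) <= V_sq Omega psi)%E.
  apply: lee_nneseries => [i _ _|i _]; first exact: L2_sq_ge0.
  rewrite /H1_sq (bigD1 k)//= addeCA leeDl// adde_ge0 ?L2_sq_ge0//.
  by apply: sume_ge0 => j _; exact: L2_sq_ge0.
have oo : (H_sq (Vgrad psi k) < +oo)%E := le_lt_trans le Voo.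
split; first by split => // i; have [_ /(_ k)[]] := h1 i.
rewrite fine_le// ge0_fin_numE//; first exact: H_sq_ge0.
by apply: nneseries_ge0 => i _ _; exact: V0.
Qed.

(** When C is bounded, the formula of the form makes sense on all of V, so the
    form is its own continuous extension. *)
Lemma form_sesquilinear : sesquilinear_on_V Omega (Defs.form Omega C).
Proof.
move=> c psi phi chi Vpsi Vphi Vchi; split; rewrite /Defs.form /inner_Hd.
- rewrite mulr_sumr -big_split; apply: eq_bigr => k _ /=.
  have [hpsi _] := in_V_grad k Vpsi; have [hphi _] := in_V_grad k Vphi.
  have [hchi _] := in_V_grad k Vchi.
  have [hm _] := mult_op_bounded hpsi; have [hm' _] := mult_op_bounded hphi.
  rewrite -(inner_H_linl mOmega c hm hm' hchi).
  by apply: inner_H_aeq => i; [exact: mult_op_lincomb_ae|exact: aeW].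
- rewrite mulr_sumr -big_split; apply: eq_bigr => k _ /=.
  have [hpsi _] := in_V_grad k Vpsi; have [hphi _] := in_V_grad k Vphi.
  have [hchi _] := in_V_grad k Vchi.
  have [hm _] := mult_op_bounded hchi.
  by rewrite -(inner_H_linr mOmega c hm hpsi hphi).
Qed.

Lemma normc_sum (s : seq 'I_d) (z : 'I_d -> R[i]) :
  normc (\sum_(k <- s) z k) <= \sum_(k <- s) normc (z k).
Proof.
elim/big_rec2 : _ => [|k b a _ ba]; first by rewrite normc0.
by apply: (le_trans (le_normcD _ _)); rewrite lerD2l.
Qed.

(** Choosing t to balance the two terms; the degenerate cases let t tend to
    infinity or to zero. *)
Lemma le_product_of_weighted_le (X A K p q : R) : 0 <= A -> 0 < K -> 0 <= p -> 0 <= q ->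
  (forall t : R, 0 < t -> X <= A * (t * (K ^+ 2 * p ^+ 2) + t^-1 * q ^+ 2)) ->
  X <= 2 * A * K * p * q.
Proof.
move=> A0 K0 p0 q0 H.
have [p_0|pn] := eqVneq p 0.
  rewrite p_0 in H *.
  rewrite mulr0 mul0r; suff Xe : forall e : R, 0 < e -> X <= e.
    by apply/ler_addgt0Pr => e e0; rewrite add0r; exact: Xe.
  move=> e e0.
  have D0 : 0 < A * q ^+ 2 + 1 by rewrite ltr_wpDl// mulr_ge0// sqr_ge0.
  have tp : 0 < (A * q ^+ 2 + 1) / e by rewrite divr_gt0.
  have := H _ tp; move/le_trans; apply.
  rewrite expr0n /= !mulr0 add0r invf_div mulrCA mulrAC ler_pdivrMr//.
  by rewrite ler_pM2l// lerDl ler01.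
have [q_0|qn] := eqVneq q 0.
  rewrite q_0 in H *.
  rewrite mulr0; suff Xe : forall e : R, 0 < e -> X <= e.
    by apply/ler_addgt0Pr => e e0; rewrite add0r; exact: Xe.
  move=> e e0.
  have D0 : 0 < A * (K ^+ 2 * p ^+ 2) + 1 by apply: ltr_wpDl => //; apply: mulr_ge0 => //; apply: mulr_ge0; exact: sqr_ge0.
  have tp : 0 < e / (A * (K ^+ 2 * p ^+ 2) + 1) by rewrite divr_gt0.
  have := H _ tp; move/le_trans; apply.
  rewrite expr0n /= mulr0 addr0 mulrCA mulrAC ler_pdivrMr// ler_pM2l//; lra.
have pp : 0 < p by rewrite lt_def pn.
have qp : 0 < q by rewrite lt_def qn.
have tp : 0 < q / (K * p) by rewrite divr_gt0// mulr_gt0.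
have := H _ tp; move/le_trans; apply; rewrite le_eqVlt; apply/orP; left; apply/eqP.
by field; rewrite qn pn gt_eqF.
Qed.

Lemma form_bounded : continuous_on_V Omega (Defs.form Omega C).
Proof.
(* The optimal weight t divides by the bound, so M + 1 replaces M, which may be
   zero. *)
exists (4 * d%:R * (M + 1)) => psi phi Vpsi Vphi.
have V0 chi : in_V chi -> 0 <= fine (V_sq Omega chi).
  move=> _; rewrite fine_ge0//; apply: nneseries_ge0 => i _ _.
  by rewrite adde_ge0 ?L2_sq_ge0// sume_ge0// => j _; exact: L2_sq_ge0.
have K0 : 0 < M + 1 by rewrite ltr_wpDl.
have pE : V_norm Omega psi ^+ 2 = fine (V_sq Omega psi) by rewrite sqr_sqrtr// V0.
have qE : V_norm Omega phi ^+ 2 = fine (V_sq Omega phi) by rewrite sqr_sqrtr// V0.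
have p0 : 0 <= V_norm Omega psi by exact: sqrtr_ge0.
have q0 : 0 <= V_norm Omega phi by exact: sqrtr_ge0.
move: (V_norm Omega psi) (V_norm Omega phi) pE qE p0 q0 => p q pE qE p0 q0.
have -> : 4 * d%:R * (M + 1) * p * q = 2 * (2 * d%:R) * (M + 1) * p * q by ring.
apply: le_product_of_weighted_le => //.
move=> t t0; rewrite pE qE; apply: (le_trans (normc_sum _ _)).
apply: (@le_trans _ _ (\sum_(k < d) 2 * (t * ((M + 1) ^+ 2 * fine (V_sq Omega psi))
    + t^-1 * fine (V_sq Omega phi)))); last first.
  by rewrite sumr_const card_ord -[leLHS]mulr_natl mulrA (mulrC d%:R).
apply: ler_sum => k _.
have [hpsi lpsi] := in_V_grad k Vpsi; have [hphi lphi] := in_V_grad k Vphi.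
have [hm lm] := mult_op_bounded hpsi.
apply: (le_trans (inner_H_le mOmega t0 hm hphi)); rewrite ler_pM2l//.
apply: lerD; rewrite ler_pM2l ?invr_gt0//; apply: (le_trans lm).
apply: ler_pM; [exact: sqr_ge0|by rewrite fine_ge0// H_sq_ge0| |exact: lpsi].
by rewrite ler_pXn2r ?nnegrE ?(ltW K0)// lerDl ler01.
Qed.

Lemma form_continuous_of_bounded : form_continuous Omega C.
Proof.
split; last first.
  by exists (Defs.form Omega C); split; [exact: form_sesquilinear|exact: form_bounded|].
move=> psi Vpsi _ k; have [h _] := in_V_grad k Vpsi.
by split; [exact: h|exact: proj1 (mult_op_bounded h)].
Qed.

End multiplication.

(** * Cutoff functions detect signs *)

Section approximation.
Context {R : realType} {n : nat}.
Variable Omega : set 'rV[R]_n.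
Hypothesis mOmega : measurable Omega.
Local Notation mu := (@lebesgue_rV R n).
Implicit Types (A B : set 'rV[R]_n) (f r W : 'rV[R]_n -> R).

Definition cutoff f := tame f /\ forall x, 0 <= f x <= 1.

Definition logistic (s : R) : R := (1 + expR (- s))^-1.

Let logistic_den (s : R) : 0 < 1 + expR (- s).
Proof. by rewrite addr_gt0// expR_gt0. Qed.

Lemma is_derive_logistic_affine (c b t : R) :
  is_derive t 1 (fun t => logistic (c * t + b))
    (c * (expR (- (c * t + b)) / (1 + expR (- (c * t + b))) ^+ 2)).
Proof.
have dl : is_derive t 1 (fun t : R => - (c * t + b)) (- c).
  rewrite (_ : (fun t => _) = - (c *: (id : R -> R) + cst b)); last exact/funext.
  by apply: is_derive_eq; rewrite addr0 [_ *: _]mulr1.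
have de : is_derive t 1 (fun t : R => 1 + expR (- (c * t + b))) (expR (- (c * t + b)) * - c).
  have dc := @is_derive1_comp _ expR (fun t : R => - (c * t + b)) t _ _ (is_derive_expR _) dl.
  rewrite (_ : (fun t => _) = cst 1 + (expR \o (fun t : R => - (c * t + b)))); last exact/funext.
  by apply: is_derive_eq; rewrite add0r.
have := @is_deriveV R (fun t : R => 1 + expR (- (c * t + b))) t _ _ (lt0r_neq0 (logistic_den (c * t + b))) de.
by move=> H; apply: is_derive_eq; rewrite /GRing.scale /=; ring.
Qed.

Lemma logistic01 s : 0 <= logistic s <= 1.
Proof.
rewrite /logistic invr_ge0 ltW//= invf_le1// lerDl.
exact: expR_ge0.
Qed.

(** The slope m^2 beats the shift m, so the argument of the logistic function
    tends to +oo for t > a, while for t <= a it is at most - m; the shift takes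
    care of the boundary point t = a. *)
Let halfspace_step (a t : R) :
  (fun m : nat => logistic (m%:R ^+ 2 * t + (- (m%:R ^+ 2 * a) - m%:R))) @ \oo
    --> ((a < t)%R%:R : R).
Proof.
pose s (m : nat) : R := m%:R ^+ 2 * t + (- (m%:R ^+ 2 * a) - m%:R).
have harm (m : nat) (y : R) : m.+1%:R <= y -> y^-1 <= harmonic m.
  move=> my; have y0 : 0 < y by rewrite (lt_le_trans _ my)// ltr0n.
  by rewrite /harmonic /= lef_pV2 ?posrE.
have [ta|at_] := leP t a.
  apply: (squeeze_cvgr _ (cvg_cst 0) (@cvg_harmonic R)); apply: nearW => m.
  have /andP[-> _] := logistic01 (s m); rewrite /=; apply: harm.
  have := expR_ge1Dx (- s m); have : s m <= - m%:R.
    rewrite /s; have : m%:R ^+ 2 * (t - a) <= 0 by rewrite mulr_ge0_le0 ?sqr_ge0// subr_le0.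
    by rewrite mulrBr; lra.
  by rewrite -natr1 /s; lra.
have [N HN] : exists N : nat, 2 / (t - a) < N%:R.
  exists (Num.bound (2 / (t - a))); apply: archi_boundP.
  by rewrite divr_ge0// subr_ge0 ltW.
rewrite -[X in _ --> X](subr0 1).
rewrite (_ : (fun m => _) = (fun m => 1 - (1 - logistic (s m)))); last first.
  by apply/funext => m; rewrite -/(s m); ring.
apply: cvgB; first exact: cvg_cst.
apply: (squeeze_cvgr _ (cvg_cst 0) (@cvg_harmonic R)).
exists N => // m /= Nm; have /andP[_ l1] := logistic01 (s m).
rewrite subr_ge0 l1 /=.
have -> : 1 - logistic (s m) = (1 + expR (s m))^-1.
  rewrite /logistic expRN; have := expR_gt0 (s m); move: (expR (s m)) => E E0.
  by field; rewrite !gt_eqF ?addr_gt0.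
apply: harm; have := expR_ge1Dx (s m); have : m%:R <= s m.
  have : 2 <= m%:R * (t - a).
    rewrite -ler_pdivrMr ?subr_gt0//; apply: (le_trans (ltW HN)).
    by rewrite ler_nat.
  move=> H; have : m%:R * 2 <= m%:R * (m%:R * (t - a)) by rewrite ler_wpM2l.
  by rewrite /s mulrA -expr2 mulrBr; lra.
by rewrite -natr1; lra.
Qed.

Definition weighted_L1 W f : R := \int[mu]_(x in Omega) (`|f x| * W x).

Definition approximable W A := measurable A /\ forall e : R, 0 < e ->
  exists f, cutoff f /\ weighted_L1 W (fun x => \1_A x - f x) < e.

Section weight.
Variable W : 'rV[R]_n -> R.
Hypothesis W0 : forall x, 0 <= W x.
Hypothesis Wi : mu.-integrable Omega (EFin \o W).

Let mW : measurable_fun Omega W.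
Proof. by apply/measurable_EFinP; exact: measurable_int Wi. Qed.

Let weighted_L1_integrable f : measurable_fun Omega f -> (forall x, `|f x| <= 1) ->
  mu.-integrable Omega (EFin \o (fun x => `|f x| * W x)).
Proof.
move=> mf f1; apply: (le_integrable mOmega _ _ Wi).
  by apply/measurable_EFinP; apply: measurable_funM => //; exact: measurableT_comp.
move=> x _ /=; rewrite lee_fin normrM normr_id (ger0_norm (W0 x)).
by rewrite ler_piMl.
Qed.

Let weighted_L1_le (f g h : 'rV[R]_n -> R) : measurable_fun Omega f -> (forall x, `|f x| <= 1) ->
  measurable_fun Omega g -> (forall x, `|g x| <= 1) ->
  measurable_fun Omega h -> (forall x, `|h x| <= 1) ->
  (forall x, `|f x| <= `|g x| + `|h x|) -> weighted_L1 W f <= weighted_L1 W g + weighted_L1 W h.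
Proof.
move=> mf f1 mg g1 mh h1 fgh; rewrite /weighted_L1; rewrite -RintegralD//; try exact: weighted_L1_integrable.
apply: le_Rintegral => //; first exact: weighted_L1_integrable.
  by have := integrableD mOmega (weighted_L1_integrable mg g1) (weighted_L1_integrable mh h1);
    apply: eq_integrable.
by move=> x _; rewrite -mulrDl ler_wpM2r.
Qed.

Let weighted_L1_cvg0 (f : nat -> 'rV[R]_n -> R) :
  (forall m, measurable_fun Omega (f m)) -> (forall m x, `|f m x| <= 1) ->
  (forall x, (fun m => f m x) @ \oo --> 0) -> (fun m => weighted_L1 W (f m)) @ \oo --> 0.
Proof.
move=> mf f1 f0.
have [] := @dominated_convergence _ _ R mu Omega mOmega
  (fun m x => (`|f m x| * W x)%:E) (cst 0%E) (EFin \o W).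
- by move=> m; apply/measurable_EFinP; apply: measurable_funM => //; exact: measurableT_comp.
- exact: measurable_cst.
- apply: aeW => x _; apply: cvg_EFin; first exact: nearW.
  have : (fun m => `|f m x| * W x) @ \oo --> `|0 : R| * W x.
    by apply: cvgMl; apply: cvg_norm; exact: f0.
  by rewrite normr0 mul0r.
- exact: Wi.
- apply: aeW => x m _; rewrite /= lee_fin normrM normr_id (ger0_norm (W0 x)).
  by rewrite ler_piMl.
move=> _ _; rewrite integral0 => /fine_cvg; exact.
Qed.

Let cutoff_measurable f : cutoff f -> measurable_fun Omega f.
Proof. by move=> [[mf _ _ _] _]; exact: measurable_funTS. Qed.

Let indic01 A x : 0 <= (\1_A x : R) <= 1.
Proof. by rewrite indicE; case: (_ \in _); rewrite ?lexx ?ler01. Qed.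

Let mindic A : measurable A -> measurable_fun Omega (\1_A : _ -> R).
Proof. by move=> mA; exact: measurable_indic. Qed.

Let dist01 (a b : R) : 0 <= a <= 1 -> 0 <= b <= 1 -> `|a - b| <= 1.
Proof. by move=> /andP[a0 a1] /andP[b0 b1]; rewrite ler_norml; apply/andP; split; lra. Qed.

Let mdist A f : measurable A -> cutoff f -> measurable_fun Omega (fun x => \1_A x - f x).
Proof. by move=> mA cf; apply: measurable_funB; [exact: mindic|exact: cutoff_measurable]. Qed.

Let dist1 A f : cutoff f -> forall x, `|\1_A x - f x| <= 1.
Proof. by move=> [_ f01] x; exact: dist01. Qed.

Let approximableC A : approximable W A -> approximable W (~` A).
Proof.
move=> [mA HA]; split; first exact: measurableC.
move=> e /HA[f [[tf f01] fe]]; exists (fun x => 1 - f x); split.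
  by split; [exact: tame_onem|move=> x; have := f01 x; lra].
rewrite (_ : weighted_L1 W _ = weighted_L1 W (fun x => \1_A x - f x))//.
apply: eq_Rintegral => x _; congr (_ * _).
rewrite -normrN; congr `|_|; rewrite !indicE in_setC.
by case: (x \in A) => /=; ring.
Qed.

Let approximableI A B : approximable W A -> approximable W B -> approximable W (A `&` B).
Proof.
move=> [mA HA] [mB HB]; split; first exact: measurableI.
move=> e e0; have e2 : 0 < e / 2 by rewrite divr_gt0.
have [f [cf fe]] := HA _ e2; have [g [cg ge]] := HB _ e2.
have [[tf f01] [tg g01]] := (cf, cg).
have cfg : cutoff (fun x => f x * g x).
  split; first exact: tameM.
  move=> x; have /andP[? ?] := f01 x; have /andP[? ?] := g01 x.
  by rewrite mulr_ge0// mulr_ile1.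
exists (fun x => f x * g x); split => //.
have mAB : measurable (A `&` B) by exact: measurableI.
apply: (@le_lt_trans _ _ (weighted_L1 W (fun x => \1_A x - f x) + weighted_L1 W (fun x => \1_B x - g x))).
  apply: weighted_L1_le; [exact: mdist|exact: dist1|exact: mdist|exact: dist1|exact: mdist|exact: dist1|].
  move=> x; rewrite indicI /=.
  rewrite (_ : _ - _ = (\1_A x - f x) * \1_B x + f x * (\1_B x - g x)); last by ring.
  apply: (le_trans (ler_normD _ _)); rewrite !normrM.
  have /andP[? ?] := f01 x; have /andP[? ?] := indic01 B x.
  rewrite (ger0_norm (x := f x))// (ger0_norm (x := \1_B x))//.
  by apply: lerD; [exact: ler_piMr|exact: ler_piMl].
by rewrite [ltRHS](splitr e) ltrD.
Qed.

Let approximable0 : approximable W set0.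
Proof.
split => // e e0; exists (cst 0); split.
  by split; [exact: tame_cst|move=> x /=; rewrite lexx ler01].
rewrite /weighted_L1; rewrite (@eq_Rintegral _ _ _ mu Omega (cst 0)) ?Rintegral_cst ?mul0r// => x _ /=.
by rewrite indicE in_set0 /= subrr normr0 mul0r.
Qed.

(** Pointwise convergence is convergence in the weighted norm, by dominated
    convergence; where f m is an indicator, a cutoff function replaces it at the
    cost of another e / 2. *)
Let approximable_limit A (f : nat -> 'rV[R]_n -> R) : measurable A ->
  (forall m, exists B, approximable W B /\ f m = \1_B \/ cutoff (f m)) ->
  (forall x, (fun m => f m x) @ \oo --> (\1_A x : R)) -> approximable W A.
Proof.
move=> mA fP fA; split => // e e0; have e2 : 0 < e / 2 by rewrite divr_gt0.
have mf m : measurable_fun Omega (f m).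
  by have [B [[[mB _] ->]|/cutoff_measurable//]] := fP m; exact: mindic.
have f01 m x : 0 <= f m x <= 1.
  by have [B [[_ ->]|[_]]] := fP m; [exact: indic01|exact].
have mAf m : measurable_fun Omega (fun x => \1_A x - f m x).
  by apply: measurable_funB => //; exact: mindic.
have Af1 m x : `|\1_A x - f m x| <= 1 by exact: dist01.
have /cvgr0_norm_lt /(_ _ e2)[m _ /(_ m (leqnn m)) fm] :
    (fun m => weighted_L1 W (fun x => \1_A x - f m x)) @ \oo --> 0.
  apply: weighted_L1_cvg0 => // x; rewrite -(subrr (\1_A x : R)).
  by apply: cvgB; [exact: cvg_cst|exact: fA].
have {}fm : weighted_L1 W (fun x => \1_A x - f m x) < e / 2 := le_lt_trans (ler_norm _) fm.
have [B [[[mB HB] fB]|cfm]] := fP m; last first.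
  by exists (f m); split => //; apply: (lt_trans fm); rewrite ltr_pdivrMr//; lra.
have [g [cg ge]] := HB _ e2; exists g; split => //.
apply: (@le_lt_trans _ _ (weighted_L1 W (fun x => \1_A x - f m x) + weighted_L1 W (fun x => \1_B x - g x))).
  apply: weighted_L1_le => //; [exact: mdist|exact: dist1|exact: mdist|exact: dist1|].
  move=> x; rewrite fB; apply: le_trans (ler_normD _ _); rewrite le_eqVlt.
  by apply/orP; left; apply/eqP; congr `|_|; ring.
by rewrite [ltRHS](splitr e) ltrD.
Qed.

Let approximable_bigcup (A : nat -> set 'rV[R]_n) :
  (forall k, approximable W (A k)) -> approximable W (\bigcup_k A k).
Proof.
move=> HA; have mA k : measurable (A k) by have [] := HA k.
have aU N : approximable W (\big[setU/set0]_(k < N) A k).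
  elim: N => [|N IH]; first by rewrite big_ord0; exact: approximable0.
  rewrite big_ord_recr/= -[X in approximable W X]setCK setCU.
  by apply: approximableC; apply: approximableI; exact: approximableC.
apply: (@approximable_limit _ (fun N => \1_(\big[setU/set0]_(k < N) A k))).
- exact: bigcup_measurable.
- by move=> N; exists (\big[setU/set0]_(k < N) A k); left.
move=> x; have [[k _ Ak]|nA] := pselect ((\bigcup_k A k) x).
  apply: (@cvg_near_cst _ _ _ _ _ _ _); exists k.+1 => // N /= kN.
  rewrite !indicE (mem_set (_ : (\bigcup_k A k) x)); last by exists k.
  by rewrite mem_set// -bigcup_mkord; exists k.
apply: cvg_near_cst; apply: nearW => N; rewrite !indicE !memNset//.
by rewrite -bigcup_mkord => -[k _ Ak]; apply: nA; exists k.
Qed.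

Let approximable_halfspace (i : 'I_n) (a : R) :
  approximable W [set x : 'rV[R]_n | a < x 0 i].
Proof.
apply: (@approximable_limit _
  (fun m x => logistic (m%:R ^+ 2 * x 0 i + (- (m%:R ^+ 2 * a) - m%:R)))).
- rewrite (_ : mkset _ = setT `&` (fun x : 'rV[R]_n => x 0 i) @^-1` `]a, +oo[%classic).
    exact: measurable_rV_coord.
  by apply/seteqP; split => x /=; rewrite in_itv /= andbT => // -[].
(* set0 is a placeholder: these functions are cutoffs, not indicators. *)
- move=> m; exists set0; right; split; last by move=> x; exact: logistic01.
  pose c : R := m%:R ^+ 2; pose b : R := - (c * a) - m%:R.
  apply: (@tame_coord _ _ (fun t => logistic (c * t + b)) _ 1 c i
    (is_derive_logistic_affine c b)).
    by move=> t; have /andP[? ?] := logistic01 (c * t + b); rewrite ger0_norm.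
  move=> t; rewrite ger0_norm; last first.
    by rewrite mulr_ge0 ?sqr_ge0// divr_ge0 ?expR_ge0 ?sqr_ge0.
  rewrite -[leRHS]mulr1 ler_wpM2l ?sqr_ge0//.
  have := expR_ge0 (- (c * t + b)); move: (expR _) => E E0.
  rewrite ler_pdivrMr ?mul1r; last by rewrite exprn_gt0// ltr_wpDr.
  by rewrite sqrrD expr1n mul1r mulr2n; have := sqr_ge0 E; lra.
- move=> x; rewrite indicE (_ : _ \in _ = (a < x 0 i)%R); first exact: halfspace_step.
  by apply/idP/idP; rewrite inE.
Qed.

Let approximable_sigma : sigma_algebra setT (approximable W).
Proof.
split; [exact: approximable0| |exact: approximable_bigcup].
by move=> A HA; rewrite setTD; exact: approximableC.
Qed.

(** The approximable sets form a sigma-algebra that contains the half-spaces, and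
    these generate the Borel sets. *)
Lemma measurable_approximable A : measurable A -> approximable W A.
Proof.
move: A; apply: smallest_sub; first exact: approximable_sigma.
rewrite -bigcup_seq/=; apply: bigcup_sub => i _ _ [B mB <-]; rewrite setTI.
have {mB} : (RGenOInfty.G (R:=R)).-sigma.-measurable B.
  by rewrite -RGenOInfty.measurableE; exact: mB.
move: B; apply: smallest_sub.
  split.
  - by rewrite preimage_set0; exact: approximable0.
  - by move=> B HB; rewrite setTD preimage_setC; exact: approximableC.
  - by move=> B HB; rewrite preimage_bigcup; exact: approximable_bigcup.
move=> _ [a ->]; have := approximable_halfspace i a; congr (approximable W).
by apply/seteqP; split => x /=; rewrite in_itv /= andbT.
Qed.

End weight.

(** Let A be the set where r is negative. Cutoff functions f approximate the
    indicator of A with respect to the weight |r|, and so do their squares, an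
    indicator being its own square. Hence the integral of r over A is
    nonnegative, which leaves A no positive measure. *)
Lemma ae_ge0_of_cutoff r : mu.-integrable Omega (EFin \o r) ->
  (forall f, cutoff f -> 0 <= \int[mu]_(x in Omega) (f x ^+ 2 * r x)) ->
  {ae mu, forall x, Omega x -> 0 <= r x}.
Proof.
move=> ri H; have mr : measurable_fun Omega r.
  by apply/measurable_EFinP; exact: measurable_int ri.
pose A := Omega `&` [set x | r x < 0].
have mA : measurable A.
  rewrite (_ : A = Omega `&` r @^-1` `]-oo, 0[%classic); first exact: mr.
  by apply/seteqP; split => x [Ox]; rewrite /= in_itv.
have ari : mu.-integrable Omega (EFin \o (fun x => `|r x|)) by exact: integrable_norm.
have Bi (f : 'rV[R]_n -> R) (B : R) : measurable_fun Omega f -> (forall x, `|f x| <= B) ->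
    mu.-integrable Omega (EFin \o (fun x => f x * r x)).
  move=> mf fB; have B0 : 0 <= B := le_trans (normr_ge0 _) (fB 0).
  have Bri : mu.-integrable Omega (EFin \o (fun x => B * `|r x|)).
    by have := integrableZl mOmega B ari; apply: eq_integrable.
  apply: (le_integrable mOmega _ _ Bri).
    by apply/measurable_EFinP; exact: measurable_funM.
  by move=> x _ /=; rewrite lee_fin !normrM normr_id ler_wpM2r// (le_trans (fB x))// ler_norm.
have indic1 x : `|\1_A x : R| <= 1.
  by rewrite indicE; case: (_ \in _); rewrite ?normr1 ?normr0.
have mI : measurable_fun Omega (\1_A : _ -> R) by exact: measurable_indic.
have A0 : 0 <= \int[mu]_(x in Omega) (\1_A x * r x).
  apply/ler_addgt0Pr => e e0; have e2 : 0 < e / 2 by rewrite divr_gt0.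
  have [_ /(_ _ e2)[f [cf fe]]] :=
    @measurable_approximable (fun x => `|r x|) (fun x => normr_ge0 _) ari A mA.
  have [[mf _ _ _] f01] := cf; have mf' : measurable_fun Omega f by exact: measurable_funTS.
  have f1 x : `|f x| <= 1 by have /andP[? ?] := f01 x; rewrite ger0_norm.
  have f21 x : `|f x ^+ 2| <= 1 by rewrite normrX expr_le1.
  have mf2 : measurable_fun Omega (fun x => f x ^+ 2) by exact: measurable_funX.
  apply: (le_trans (H f cf)); rewrite -lerBlDl -RintegralB//; try exact: Bi.
  have mD : measurable_fun Omega (fun x => \1_A x - f x) by exact: measurable_funB.
  have D1 x : `|\1_A x - f x| <= 2.
    by rewrite (le_trans (ler_normB _ _))// (_ : 2 = 1 + 1)// lerD.
  have Di : mu.-integrable Omega (EFin \o (fun x => `|\1_A x - f x| * `|r x|)).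
    have := integrable_norm (Bi _ _ mD D1); apply: eq_integrable => // x _ /=.
    by rewrite normrM.
  apply: (@le_trans _ _ (\int[mu]_(x in Omega) (2 * (`|\1_A x - f x| * `|r x|)))).
    apply: le_Rintegral => //.
    - by have := integrableB mOmega (Bi _ _ mf2 f21) (Bi _ _ mI indic1); apply: eq_integrable.
    - by have := integrableZl mOmega 2 Di; apply: eq_integrable.
    move=> x _; rewrite -mulrBl; apply: (le_trans (ler_norm _)); rewrite normrM mulrA.
    rewrite ler_wpM2r//.
    rewrite (_ : f x ^+ 2 - \1_A x = - ((\1_A x - f x) * (\1_A x + f x))); last first.
      by rewrite indicE; case: (_ \in _); rewrite /=; ring.
    rewrite normrN normrM mulrC ler_wpM2r// (le_trans (ler_normD _ _))//.
    by rewrite (_ : 2 = 1 + 1)// lerD.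
  by rewrite RintegralZl// mulrC -ler_pdivlMr// ltW.
have E : (\int[mu]_(x in Omega) `|(\1_A x * r x)%:E| = 0)%E.
  have AN x : (`|(\1_A x * r x)%:E| = (- (\1_A x * r x))%:E)%E.
    rewrite /=; congr EFin; rewrite indicE; have [|] := boolP (x \in A).
      by rewrite inE => -[_ /= rx]; rewrite mul1r ltr0_norm.
    by rewrite mul0r normr0 oppr0.
  have Ni : mu.-integrable Omega (EFin \o (fun x => - (\1_A x * r x))).
    by have := integrableN (Bi _ _ mI indic1); apply: eq_integrable.
  have NE : \int[mu]_(x in Omega) (- (\1_A x * r x)) = - \int[mu]_(x in Omega) (\1_A x * r x).
    by under eq_Rintegral do rewrite -mulN1r; rewrite RintegralZl ?mulN1r//; exact: Bi.
  have I0 : 0 <= \int[mu]_(x in Omega) (- (\1_A x * r x)).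
    by apply: Rintegral_ge0 => x _; rewrite -lee_fin -AN; exact: abse_ge0.
  under eq_integral do rewrite AN.
  have := integrable_fin_num mOmega Ni => /fineK <-; congr EFin.
  rewrite -/(Rintegral mu Omega (fun x => - (\1_A x * r x))) NE.
  by apply/eqP; rewrite oppr_eq0 eq_le A0 andbT -oppr_ge0 -NE.
have /(ae_eq_integral_abs mu mOmega) : measurable_fun Omega (EFin \o (fun x => \1_A x * r x)).
  by apply/measurable_EFinP; exact: measurable_funM.
move=> [/(_ E) + _]; apply: filterS => x /= Hx Ox; rewrite leNgt; apply/negP => rx.
move: (Hx Ox) => -[]; rewrite indicE mem_set ?mul1r; last by split.
by move=> r0; rewrite r0 ltxx in rx.
Qed.

End approximation.

(** * The form on elementary tensors *)

Section elementary_tensors.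
Context {R : realType} {d : nat}.
Variable Omega : set 'rV[R]_d.
Hypothesis mOmega : measurable Omega.
Hypothesis Omega_lty : (@lebesgue_rV R d Omega < +oo)%E.
Local Notation mu := (@lebesgue_rV R d).
Local Notation cfun := ('rV[R]_d -> R[i]).
Implicit Types (u v w h : 'rV[R]_d -> R) (xi zeta : nat -> R[i]) (f g : cfun).

Lemma bounded_Omega_integrable h (B : R) : measurable_fun Omega h ->
  (forall x, `|h x| <= B) -> mu.-integrable Omega (EFin \o h).
Proof. by move=> mh hB; exact: (@bounded_integrable _ _ _ _ _ _ B mOmega Omega_lty mh). Qed.

Lemma tame_sqr_integrable u : tame u ->
  mu.-integrable Omega (EFin \o (fun x => u x ^+ 2)).
Proof.
move=> [mu_ [B uB] _ _]; apply: (@bounded_Omega_integrable _ (B ^+ 2)).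
  by apply: measurable_funX; exact: measurable_funTS.
by move=> x; rewrite normrX ler_pXn2r// nnegrE (le_trans _ (uB x)).
Qed.

Lemma tame_partial_sqr_integrable k u : tame u ->
  mu.-integrable Omega (EFin \o (fun x => partial k u x ^+ 2)).
Proof.
move=> tu; have [B uB] := tame_partial_bounded k tu.
apply: (@bounded_Omega_integrable _ (B ^+ 2)).
  by apply: measurable_funX; apply: measurable_funTS; exact: tame_partial_measurable.
by move=> x; rewrite normrX ler_pXn2r// nnegrE (le_trans _ (uB x)).
Qed.

Lemma cmeasurable_scale (c : R[i]) h : measurable_fun Omega h ->
  cmeasurable Omega (fun x => c * (h x)%:C%C).
Proof.
move=> mh; split.
- rewrite (_ : (fun x => _) = fun x => cRe c * h x); first exact: measurable_funM.
  by apply/funext => x; rewrite cReM /= mulr0 subr0.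
- rewrite (_ : (fun x => _) = fun x => cIm c * h x); first exact: measurable_funM.
  by apply/funext => x; rewrite cImM /= mulr0 add0r.
Qed.

Lemma normc_sqr_scale (c : R[i]) (t : R) :
  normc (c * t%:C%C) ^+ 2 = normc c ^+ 2 * t ^+ 2.
Proof. by rewrite normcM exprMn /= expr0n /= addr0 sqrtr_sqr real_normK ?num_real. Qed.

Lemma L2_sq_scale (c : R[i]) h : measurable_fun Omega h ->
  mu.-integrable Omega (EFin \o (fun x => h x ^+ 2)) ->
  L2_sq Omega (fun x => c * (h x)%:C%C) =
    (normc c ^+ 2 * \int[mu]_(x in Omega) (h x ^+ 2))%:E.
Proof.
move=> mh hi; rewrite -RintegralZl// /L2_sq /Rintegral fineK.
  by apply: eq_integral => x _; rewrite normc_sqr_scale.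
apply: integrable_fin_num => //.
by have := integrableZl mOmega (normc c ^+ 2) hi; apply: eq_integrable.
Qed.

Lemma cintegral_scale (c : R[i]) h : mu.-integrable Omega (EFin \o h) ->
  cintegral Omega (fun x => c * (h x)%:C%C) = c * (\int[mu]_(x in Omega) h x)%:C%C.
Proof.
move=> hi; apply: complex_ext; rewrite /cintegral.
- rewrite cReM /= mulr0 subr0 -RintegralZl//; apply: eq_Rintegral => x _.
  by rewrite cReM /= mulr0 subr0.
- rewrite cImM /= mulr0 add0r -RintegralZl//; apply: eq_Rintegral => x _.
  by rewrite cImM /= mulr0 add0r.
Qed.

Definition tensor xi u : Vfun :=
  MkVfun (fun i x => xi i * (u x)%:C%C) (fun k i x => xi i * (partial k u x)%:C%C).

(** The squared norm of u in H^1. *)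
Definition energy u : R := \int[mu]_(x in Omega) (u x ^+ 2) +
  \sum_(k < d) \int[mu]_(x in Omega) (partial k u x ^+ 2).

Lemma energy_ge0 u : 0 <= energy u.
Proof.
rewrite addr_ge0 ?sumr_ge0// => [|k _]; apply: Rintegral_ge0 => x _; exact: sqr_ge0.
Qed.

(** The classical gradient of a tame function is its weak gradient, by
    integration by parts. *)
Lemma in_H1_scale (c : R[i]) u : tame u ->
  in_H1 Omega (fun x => c * (u x)%:C%C) (fun k x => c * (partial k u x)%:C%C).
Proof.
move=> tu; have [mu_ [B uB] _ _] := tu; split.
  apply/in_L2P; exists (fun x => c * (u x)%:C%C); split; last 1 first.
  - by rewrite L2_sq_scale ?ltry//; [exact: measurable_funTS|exact: tame_sqr_integrable].
  - by apply: cmeasurable_scale; exact: measurable_funTS.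
  - exact: aeW.
move=> k; have mp : measurable_fun Omega (partial k u).
  by apply: measurable_funTS; exact: tame_partial_measurable.
have [L pL] := tame_partial_bounded k tu.
split.
  apply/in_L2P; exists (fun x => c * (partial k u x)%:C%C); split.
  - exact: cmeasurable_scale.
  - exact: aeW.
  - by rewrite L2_sq_scale ?ltry//; exact: tame_partial_sqr_integrable.
move=> f tf; have [[mf [B' fB] _ _] _ _] := test_functionP tf.
have [tamef _ _] := test_functionP tf.
have [L' fL] := tame_partial_bounded k tamef.
have E (a b : R) : c * a%:C%C * b%:C%C = c * (a * b)%:C%C by rewrite -mulrA -rmorphM.
rewrite (_ : (fun x => _) = (fun x => c * (u x * partial k f x)%:C%C)); last first.
  by apply/funext => x; exact: E.
rewrite (_ : (fun x => c * (partial k u x)%:C%C * _) =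
    (fun x => c * (partial k u x * f x)%:C%C)); last by apply/funext => x; exact: E.
rewrite !cintegral_scale.
- by rewrite (integration_by_parts k tu tf) rmorphN mulrN.
- apply: (@bounded_Omega_integrable _ (L * B')).
    by apply: measurable_funM => //; exact: measurable_funTS.
  by move=> x; rewrite normrM ler_pM.
- apply: (@bounded_Omega_integrable _ (B * L')).
    apply: measurable_funM; apply: measurable_funTS => //.
    exact: tame_partial_measurable.
  by move=> x; rewrite normrM ler_pM.
Qed.

Lemma H1_sq_scale (c : R[i]) u : tame u ->
  H1_sq Omega (fun x => c * (u x)%:C%C) (fun k x => c * (partial k u x)%:C%C) =
  (normc c ^+ 2 * energy u)%:E.
Proof.
move=> tu; have [mu_ _ _ _] := tu; rewrite /H1_sq L2_sq_scale; last 2 first.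
- exact: measurable_funTS.
- exact: tame_sqr_integrable.
rewrite mulrDr EFinD; congr (_ + _)%E; rewrite mulr_sumr -sumEFin; apply: eq_bigr => k _.
rewrite L2_sq_scale//; last exact: tame_partial_sqr_integrable.
by apply: measurable_funTS; exact: tame_partial_measurable.
Qed.

(** The norm factorises over an elementary tensor. *)
Lemma in_V_tensor (N : nat) xi u : tame u ->
  [/\ in_V Omega (tensor (trunc N xi) u), finite_sequence Omega (tensor (trunc N xi) u) &
      V_norm Omega (tensor (trunc N xi) u) ^+ 2 <= psum2 xi N * energy u].
Proof.
move=> tu.
have VE : V_sq Omega (tensor (trunc N xi) u) =
    (\sum_(i <oo) (normc (trunc N xi i) ^+ 2 * energy u)%:E)%E.
  by apply: eq_eseriesr => i _; exact: H1_sq_scale.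
have t0 i : 0 <= normc (trunc N xi i) ^+ 2 * energy u.
  by rewrite mulr_ge0 ?energy_ge0// sqr_ge0.
have [Voo Vle] : (V_sq Omega (tensor (trunc N xi) u) < +oo)%E /\
    fine (V_sq Omega (tensor (trunc N xi) u)) <= psum2 xi N * energy u.
  rewrite VE; apply: nneseries_bounded => // m; rewrite /series /= -mulr_suml.
  by rewrite ler_wpM2r ?energy_ge0//; exact: psum2_trunc.
split.
- by split => // i; exact: in_H1_scale.
- exists N => i Ni; apply: aeW => x _ /=; rewrite /trunc ltnNge Ni /= mul0r.
  by split => // k; rewrite mul0r.
- rewrite sqr_sqrtr// fine_ge0// VE; apply: nneseries_ge0 => i _ _.
  by rewrite lee_fin.
Qed.

Lemma cseries_finite (z : nat -> R[i]) (N : nat) : (forall i, (N <= i)%N -> z i = 0) ->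
  cseries z = \sum_(0 <= i < N) z i.
Proof.
move=> z0.
have E (p : R[i] -> R) : p 0 = 0 -> limn (series (p \o z)) = \sum_(0 <= i < N) p (z i).
  move=> p0; apply: cvg_lim => //; apply: cvg_near_cst; exists N => // m /= Nm.
  rewrite /series /= (big_cat_nat (leq0n N) Nm)//= [X in _ + X]big1_seq ?addr0// => i /andP[_].
  by rewrite mem_index_iota => /andP[Ni _]; rewrite z0.
apply: complex_ext; rewrite /cseries /= ?cRe_sum ?cIm_sum.
- exact: (E (@complex.Re R)).
- exact: (E (@complex.Im R)).
Qed.

Lemma integrable_mul_bounded (p h : 'rV[R]_d -> R) (B : R) :
  mu.-integrable Omega (EFin \o p) -> measurable_fun Omega h -> (forall x, `|h x| <= B) ->
  mu.-integrable Omega (EFin \o (fun x => p x * h x)).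
Proof.
move=> pi mh hB; have B0 : 0 <= B := le_trans (normr_ge0 _) (hB 0).
have Bpi : mu.-integrable Omega (EFin \o (fun x => B * p x)).
  by have := integrableZl mOmega B pi; apply: eq_integrable.
apply: (le_integrable mOmega _ _ Bpi).
  apply/measurable_EFinP; apply: measurable_funM => //.
  by apply/measurable_EFinP; exact: measurable_int pi.
by move=> x _ /=; rewrite lee_fin !normrM mulrC (ger0_norm B0) ler_wpM2r.
Qed.

Lemma cintegrable_scale_bounded f h (B : R) : cintegrable Omega f ->
  measurable_fun Omega h -> (forall x, `|h x| <= B) ->
  cintegrable Omega (fun x => f x * (h x)%:C%C).
Proof.
move=> [fr fi] mh hB.
have S p pi := @integrable_mul_bounded p h B pi mh hB.
split; [apply: eq_integrable (S _ fr) => // x _ /=|apply: eq_integrable (S _ fi) => // x _ /=];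
  by rewrite ?cReM ?cImM /= mulr0 ?subr0 ?add0r.
Qed.

Lemma cintegrable_sum (F : nat -> cfun) N : (forall i, cintegrable Omega (F i)) ->
  cintegrable Omega (fun x => \sum_(0 <= i < N) F i x).
Proof.
move=> FI; elim: N => [|N [IHr IHi]].
  by split; apply: eq_integrable (integrable0 mu Omega) => // x _ /=; rewrite big_nil.
have [Fr Fi] := FI N; split.
- have := integrableD mOmega IHr Fr; apply: eq_integrable => // x _ /=.
  by rewrite big_nat_recr//= cReD EFinD.
- have := integrableD mOmega IHi Fi; apply: eq_integrable => // x _ /=.
  by rewrite big_nat_recr//= cImD EFinD.
Qed.

Lemma cintegrableZ (c : R[i]) f : cintegrable Omega f -> cintegrable Omega (fun x => c * f x).
Proof.
move=> [fr fi]; have Z (a : R) (p : 'rV[R]_d -> R) : mu.-integrable Omega (EFin \o p) ->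
    mu.-integrable Omega (EFin \o (fun x => a * p x)).
  by move=> pi; have := integrableZl mOmega a pi; apply: eq_integrable.
split.
- have := integrableB mOmega (Z (cRe c) _ fr) (Z (cIm c) _ fi).
  by apply: eq_integrable => // x _ /=; rewrite cReM EFinB.
- have := integrableD mOmega (Z (cRe c) _ fi) (Z (cIm c) _ fr).
  by apply: eq_integrable => // x _ /=; rewrite cImM EFinD.
Qed.

Lemma Rintegral_sum_nat (p : nat -> 'rV[R]_d -> R) N :
  (forall i, mu.-integrable Omega (EFin \o p i)) ->
  \int[mu]_(x in Omega) (\sum_(0 <= i < N) p i x) =
  \sum_(0 <= i < N) \int[mu]_(x in Omega) p i x.
Proof.
move=> pi; have si m : mu.-integrable Omega (EFin \o (fun x => \sum_(0 <= i < m) p i x)).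
  elim: m => [|m IH].
    by apply: eq_integrable (integrable0 mu Omega) => // x _ /=; rewrite big_nil.
  have := integrableD mOmega IH (pi m); apply: eq_integrable => // x _ /=.
  by rewrite big_nat_recr//= EFinD.
elim: N => [|N IH].
  rewrite big_nil (@eq_Rintegral _ _ _ mu Omega (cst 0)) ?Rintegral_cst ?mul0r// => x _.
  by rewrite big_nil.
rewrite big_nat_recr//= -IH -RintegralD//.
by apply: eq_Rintegral => x _; rewrite big_nat_recr.
Qed.

Variable C : 'rV[R]_d -> ell2_op R.
Variable c : nat -> nat -> cfun.
Hypothesis mc : forall i j, cmeasurable Omega (c i j).
Hypothesis Cc : {ae mu, forall x, Omega x -> forall i j, ell2_entry (C x) i j = c i j x}.

Definition sesqui_at N xi zeta x : R[i] := sesqui (fun i j => c i j x) xi zeta N.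

(** A finite sequence meets finitely many entries only, so the series that
    defines the multiplication operator is a finite sum. *)
Lemma mult_op_tensor N xi u k i : tame u ->
  aeq Omega (mult_op C (Vgrad (tensor (trunc N xi) u) k) i)
    (fun x => (\sum_(0 <= j < N) c i j x * xi j) * (partial k u x)%:C%C).
Proof.
move=> tu; apply: filterS Cc => x + Ox => /(_ Ox) xc; rewrite /mult_op (@cseries_finite _ N).
  rewrite mulr_suml; apply: eq_big_nat => j /andP[_ jN].
  by rewrite /= /trunc jN xc mulrA.
by move=> j Nj; rewrite /= /trunc ltnNge Nj /= mul0r mulr0.
Qed.

Hypothesis ci : forall i j, cintegrable Omega (c i j).

Lemma sesqui_at_integrable N xi zeta :
  mu.-integrable Omega (EFin \o (fun x => cRe (sesqui_at N xi zeta x))).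
Proof.
apply: proj1 (_ : cintegrable Omega (sesqui_at N xi zeta)).
apply: cintegrable_sum => i.
have := cintegrableZ (conjc (zeta i)) (@cintegrable_sum (fun j x => xi j * c i j x) N
  (fun j => cintegrableZ (xi j) (ci i j))).
congr (cintegrable _ _); apply/funext => x; rewrite mulrC; congr (_ * _).
by apply: eq_bigr => j _; rewrite mulrC.
Qed.

(** On elementary tensors with the same real factor u the form is the Dirichlet
    integral of u, weighted by the value of C (x) on the two vectors. *)
Lemma cRe_form_tensor N xi zeta u : tame u ->
  cRe (Defs.form Omega C (tensor (trunc N xi) u) (tensor (trunc N zeta) u)) =
  \sum_(k < d) \int[mu]_(x in Omega) (cRe (sesqui_at N xi zeta x) * partial k u x ^+ 2).
Proof.
move=> tu; rewrite /Defs.form /inner_Hd cRe_sum; apply: eq_bigr => k _.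
have [L pL] := tame_partial_bounded k tu.
have mp : measurable_fun Omega (partial k u).
  by apply: measurable_funTS; exact: tame_partial_measurable.
pose b i : cfun := fun x => (\sum_(0 <= j < N) c i j x * xi j) * conjc (zeta i).
have bi i : cintegrable Omega (b i).
  have := cintegrableZ (conjc (zeta i)) (@cintegrable_sum (fun j x => xi j * c i j x) N
    (fun j => cintegrableZ (xi j) (ci i j))).
  congr (cintegrable _ _); apply/funext => x; rewrite mulrC; congr (_ * _).
  by apply: eq_bigr => j _; rewrite mulrC.
have bpi i : cintegrable Omega (fun x => b i x * (partial k u x ^+ 2)%:C%C).
  apply: (@cintegrable_scale_bounded _ _ (L ^+ 2)) => //; first exact: measurable_funX.
  by move=> x; rewrite normrX ler_pXn2r// nnegrE (le_trans _ (pL x)).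
rewrite /inner_H (@cseries_finite _ N); last first.
  move=> i Ni; rewrite (_ : (fun x => _) = fun x => 0 * (0 : R)%:C%C).
    by rewrite cintegral_scale ?mul0r//; exact: integrable0.
  apply/funext => x; rewrite /= /trunc [(i < N)%N]ltnNge Ni /=.
  by apply: complex_ext; rewrite !cE /=; ring.
rewrite cRe_sum.
transitivity (\sum_(0 <= i < N) \int[mu]_(x in Omega) (cRe (b i x) * partial k u x ^+ 2)).
  apply: eq_big_nat => i /andP[_ iN].
  rewrite (@cintegral_aeq _ _ Omega _ (fun x => b i x * (partial k u x ^+ 2)%:C%C)); last first.
    apply: filterS (mult_op_tensor N xi k i tu) => x H Ox; rewrite (H Ox) /= /trunc iN /b.
    by apply: complex_ext; rewrite !cE /=; ring.
  by rewrite /cintegral /=; apply: eq_Rintegral => x _; rewrite cReM /= mulr0 subr0.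
rewrite -Rintegral_sum_nat; last first.
  move=> i; have [H _] := bpi i; apply: eq_integrable H => // x _ /=.
  by rewrite cReM /= mulr0 subr0.
by apply: eq_Rintegral => x _; rewrite -mulr_suml /sesqui_at /sesqui cRe_sum.
Qed.

End elementary_tensors.

(** * Oscillating test functions *)

Section oscillation.
Context {R : realType} {d : nat}.
Local Notation mu := (@lebesgue_rV R d).
Variable i0 : 'I_d.
Implicit Types (s t : R) (x : 'rV[R]_d) (a b eta q : 'rV[R]_d -> R).

Let is_derive_cosZ s t : is_derive t 1 (fun t => cos (s * t)) (- sin (s * t) * s).
Proof.
apply: (@is_derive1_comp _ cos (fun t => s * t)).
rewrite (_ : (fun t => _) = s *: (id : R -> R)); last exact/funext.
by apply: is_derive_eq; rewrite [_ *: _]mulr1.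
Qed.

Let is_derive_sinZ s t : is_derive t 1 (fun t => sin (s * t)) (cos (s * t) * s).
Proof.
apply: (@is_derive1_comp _ sin (fun t => s * t)).
rewrite (_ : (fun t => _) = s *: (id : R -> R)); last exact/funext.
by apply: is_derive_eq; rewrite [_ *: _]mulr1.
Qed.

(** The pair (cos (s x_0), sin (s x_0)), where x_0 is the coordinate i0,
    described by the properties that the computations below rely on. *)
Definition wave s a b : Prop :=
  [/\ tame a, tame b, forall x, a x ^+ 2 + b x ^+ 2 = 1,
      forall k x, partial k a x = (i0 == k)%:R * (- b x * s) &
      forall k x, partial k b x = (i0 == k)%:R * (a x * s)].

Lemma wave_exists s : exists a b, wave s a b.
Proof.
exists (fun x => cos (s * x 0 i0)), (fun x => sin (s * x 0 i0)); split.
- apply: (@tame_coord _ _ (fun t => cos (s * t)) _ 1 `|s| i0 (is_derive_cosZ s)).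
    by move=> t; exact: cos_max.
  by move=> t; rewrite normrM normrN ler_piMl// sin_max.
- apply: (@tame_coord _ _ (fun t => sin (s * t)) _ 1 `|s| i0 (is_derive_sinZ s)).
    by move=> t; exact: sin_max.
  by move=> t; rewrite normrM ler_piMl// cos_max.
- by move=> x; exact: cos2Dsin2.
- by move=> k x; exact: (partial_coord i0 k x (is_derive_cosZ s)).
- by move=> k x; exact: (partial_coord i0 k x (is_derive_sinZ s)).
Qed.

(** In the sum over the cosine and the sine wave the mixed terms cancel, so the
    oscillating factor leaves no trace except for the factor s^2. *)
Lemma partial_wave_sqr s a b eta k x : wave s a b -> tame eta ->
  partial k (fun x => a x * eta x) x ^+ 2 + partial k (fun x => b x * eta x) x ^+ 2 =
  (i0 == k)%:R * (s ^+ 2 * eta x ^+ 2) + partial k eta x ^+ 2.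
Proof.
move=> [ta tb ab pa pb] te; rewrite !partialM// pa pb; have := ab x.
move: (a x) (b x) (partial k eta x) (eta x) => y z p e yz.
transitivity ((y ^+ 2 + z ^+ 2) * ((i0 == k)%:R * (i0 == k)%:R * (s ^+ 2 * e ^+ 2) + p ^+ 2)).
  by ring.
by rewrite yz mul1r; case: eqP => _; rewrite ?mulr1 ?mul0r.
Qed.

Variable Omega : set 'rV[R]_d.
Hypothesis mOmega : measurable Omega.

Lemma weighted_gradient_wave q s a b eta :
  mu.-integrable Omega (EFin \o q) -> wave s a b -> tame eta ->
  \sum_(k < d) \int[mu]_(x in Omega) (q x * partial k (fun x => a x * eta x) x ^+ 2) +
  \sum_(k < d) \int[mu]_(x in Omega) (q x * partial k (fun x => b x * eta x) x ^+ 2) =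
  s ^+ 2 * \int[mu]_(x in Omega) (q x * eta x ^+ 2) +
  \sum_(k < d) \int[mu]_(x in Omega) (q x * partial k eta x ^+ 2).
Proof.
move=> qi wab te; have [ta tb _ _ _] := wab; have pi k u : tame u ->
    mu.-integrable Omega (EFin \o (fun x => q x * partial k u x ^+ 2)).
  move=> tu; have [B uB] := tame_partial_bounded k tu.
  apply: (@integrable_mul_bounded _ _ _ mOmega _ _ (B ^+ 2)) => //.
    by apply: measurable_funX; apply: measurable_funTS; exact: tame_partial_measurable.
  by move=> x; rewrite normrX ler_pXn2r// nnegrE (le_trans _ (uB x)).
have ei : mu.-integrable Omega (EFin \o (fun x => q x * eta x ^+ 2)).
  have [me [B eB] _ _] := te.
  apply: (@integrable_mul_bounded _ _ _ mOmega _ _ (B ^+ 2)) => //.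
    by apply: measurable_funX; exact: measurable_funTS.
  by move=> x; rewrite normrX ler_pXn2r// nnegrE (le_trans _ (eB x)).
rewrite -big_split /=.
have E k : \int[mu]_(x in Omega) (q x * partial k (fun x => a x * eta x) x ^+ 2) +
    \int[mu]_(x in Omega) (q x * partial k (fun x => b x * eta x) x ^+ 2) =
    (i0 == k)%:R * (s ^+ 2 * \int[mu]_(x in Omega) (q x * eta x ^+ 2)) +
    \int[mu]_(x in Omega) (q x * partial k eta x ^+ 2).
  rewrite -(RintegralD mOmega (pi k _ (tameM ta te)) (pi k _ (tameM tb te))).
  have mi : mu.-integrable Omega
      (EFin \o (fun x => (i0 == k)%:R * s ^+ 2 * (q x * eta x ^+ 2))).
    by have := integrableZl mOmega ((i0 == k)%:R * s ^+ 2) ei; apply: eq_integrable.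
  rewrite mulrA -(RintegralZl _ mOmega ei) -(RintegralD mOmega mi (pi k eta te)).
  by apply: eq_Rintegral => x _; rewrite -mulrDr (partial_wave_sqr k x wab te); ring.
rewrite (eq_bigr _ (fun k _ => E k)) big_split /=; congr (_ + _).
rewrite (bigD1 i0)//= eqxx mul1r big1 ?addr0// => k.
by rewrite eq_sym => /negbTE ->; rewrite mul0r.
Qed.

Hypothesis Omega_lty : (@lebesgue_rV R d Omega < +oo)%E.

Lemma energy_wave s a b eta : wave s a b -> tame eta ->
  energy Omega (fun x => a x * eta x) + energy Omega (fun x => b x * eta x) =
  s ^+ 2 * \int[mu]_(x in Omega) (eta x ^+ 2) + energy Omega eta.
Proof.
move=> wab te; have [ta tb ab _ _] := wab.
have i1 : mu.-integrable Omega (EFin \o (cst 1 : 'rV[R]_d -> R)).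
  by apply: (@bounded_Omega_integrable _ _ _ mOmega Omega_lty _ 1) => // x; rewrite normr1.
have m1 (h : 'rV[R]_d -> R) : \int[mu]_(x in Omega) (cst 1 x * h x) = \int[mu]_(x in Omega) h x.
  by apply: eq_Rintegral => x _; rewrite mul1r.
pose W (u : 'rV[R]_d -> R) := \sum_(k < d) \int[mu]_(x in Omega) (cst 1 x * partial k u x ^+ 2).
have EW u : energy Omega u = \int[mu]_(x in Omega) (u x ^+ 2) + W u.
  by congr (_ + _); apply: eq_bigr => k _; rewrite m1.
have E : W (fun x => a x * eta x) + W (fun x => b x * eta x) =
    s ^+ 2 * \int[mu]_(x in Omega) (eta x ^+ 2) + W eta.
  by rewrite -(m1 (fun x => eta x ^+ 2)); exact: weighted_gradient_wave i1 wab te.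
have D : \int[mu]_(x in Omega) ((a x * eta x) ^+ 2) +
    \int[mu]_(x in Omega) ((b x * eta x) ^+ 2) = \int[mu]_(x in Omega) (eta x ^+ 2).
  rewrite -(RintegralD mOmega (tame_sqr_integrable mOmega Omega_lty (tameM ta te))
                              (tame_sqr_integrable mOmega Omega_lty (tameM tb te))).
  by apply: eq_Rintegral => x _; rewrite !exprMn -mulrDl ab mul1r.
by rewrite !EW addrACA E D; ring.
Qed.

End oscillation.

(** Divide by s^2 and let s tend to infinity. *)
Lemma quadratic_growth_le (R : realType) (A B D E : R) :
  (forall s : R, s ^+ 2 * A + B <= s ^+ 2 * D + E) -> A <= D.
Proof.
move=> H; rewrite leNgt; apply/negP => DA; have AD : 0 < A - D by rewrite subr_gt0.
(* With this s >= 1, s^2 (A - D) >= s (A - D) exceeds E - B. *)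
pose s : R := (`|E - B| + 1) / (A - D) + 1.
have s1 : 1 <= s by rewrite lerDr; apply: divr_ge0; [exact: addr_ge0|exact: ltW].
have sE : s * (A - D) = `|E - B| + 1 + (A - D) by rewrite mulrDl mul1r divfK ?gt_eqF.
have ss : s * (A - D) <= s ^+ 2 * (A - D).
  by rewrite ler_pM2r// expr2 ler_peMl// (le_trans ler01).
have := H s; have := ler_norm (E - B); rewrite sE mulrBr in ss; lra.
Qed.

(** * Continuous forms come from bounded families *)

Section boundedness.
Context {R : realType} {d : nat}.
Variable Omega : set 'rV[R]_d.
Hypothesis mOmega : measurable Omega.
Hypothesis Omega_lty : (@lebesgue_rV R d Omega < +oo)%E.
Local Notation mu := (@lebesgue_rV R d).
Local Notation cfun := ('rV[R]_d -> R[i]).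
Variable i0 : 'I_d.
Variable C : 'rV[R]_d -> ell2_op R.
Hypothesis mC : componentwise_measurable Omega C.
Hypothesis contC : form_continuous Omega C.

(** Test the domain condition with cos (x_0) and sin (x_0), where x_0 is the
    coordinate i0, times the unit vector j. These lie in H^1 because Omega has
    finite measure, and the condition says that the products of the entry with
    sin (x_0) and with cos (x_0) are square integrable; the two squares add up to
    the square of the entry. *)
Lemma entry_integrable (c : nat -> nat -> cfun) : (forall i j, cmeasurable Omega (c i j)) ->
  {ae mu, forall x, Omega x -> forall i j, ell2_entry (C x) i j = c i j x} ->
  forall i j, cintegrable Omega (c i j).
Proof.
move=> mc Cc i j.
pose g (w : 'rV[R]_d -> R) : cfun := fun x => c i j x * (partial i0 w x)%:C%C.
have L w : tame w -> (L2_sq Omega (g w) < +oo)%E.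
  move=> tw; have [Vw Fw _] := in_V_tensor mOmega Omega_lty j.+1 (ell2_unit j) tw.
  have [dom _] := contC; have [_ [/(_ i)[_]]] := dom _ Vw Fw i0.
  rewrite (@L2_sq_aeq _ _ Omega _ (fun x => (\sum_(0 <= m < j.+1) c i m x * ell2_unit j m)
    * (partial i0 w x)%:C%C)); last exact: mult_op_tensor.
  move=> + _; congr (_ < _)%E; congr (L2_sq Omega _); apply/funext => x; congr (_ * _).
  rewrite big_nat_recr//= big1_seq ?add0r /ell2_unit ?eqxx ?mulr1// => m /andP[_].
  by rewrite mem_index_iota => /andP[_ mj]; rewrite ltn_eqF// mulr0.
have [a [b wab]] := wave_exists i0 (1 : R); have [ta tb ab pa pb] := wab.
have cm w : tame w -> cmeasurable Omega (g w).
  move=> tw; apply: cmeasurableM => //; split => /=; last exact: measurable_cst.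
  by apply: measurable_funTS; exact: tame_partial_measurable.
have cL : L2_sq Omega (c i j) = (L2_sq Omega (g b) + L2_sq Omega (g a))%E.
  rewrite /L2_sq -ge0_integralD//; try by move=> x _; rewrite lee_fin sqr_ge0.
  - apply: eq_integral => x _; rewrite -EFinD; congr EFin; rewrite /g !normc_sqr_scale -mulrDr.
    have -> : partial i0 b x ^+ 2 + partial i0 a x ^+ 2 = a x ^+ 2 + b x ^+ 2.
      by rewrite pa pb eqxx /=; ring.
    by rewrite ab mulr1.
  - by apply: measurable_normc_sqrE; exact: cm.
  - by apply: measurable_normc_sqrE; exact: cm.
have := L _ ta; have := L _ tb; move=> boo aoo; have coo' : (L2_sq Omega (c i j) < +oo)%E.
  by rewrite [ltLHS]cL; exact: (lte_add_pinfty boo aoo).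
(* A square integrable function on a set of finite measure is integrable. *)
have one : (L2_sq Omega (cst 1%R : cfun) < +oo)%E.
  rewrite /L2_sq (eq_integral (cst 1%:E)); last first.
    by move=> x _; rewrite /= expr1n expr0n /= addr0 sqrtr1 expr1n.
  by rewrite integral_cst// mul1e.
have := cintegrable_mul mOmega (mc i j) (cmeasurable_cst Omega 1) coo' one.
by congr cintegrable; apply/funext => x; apply: complex_ext; rewrite !cE /=; ring.
Qed.

(** Continuity of the form together with 2 p q <= p^2 + q^2. *)
Lemma form_tensor_le : exists2 K : R, 0 < K & forall N xi zeta u, tame u ->
  cRe (Defs.form Omega C (tensor (trunc N xi) u) (tensor (trunc N zeta) u)) <=
  K * (psum2 xi N + psum2 zeta N) * energy Omega u.
Proof.
have [_ [a [_ [M aM] aE]]] := contC; exists (`|M| + 1); first by rewrite ltr_wpDl.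
move=> N xi zeta u tu.
have [V1 F1 n1] := in_V_tensor mOmega Omega_lty N xi tu.
have [V2 F2 n2] := in_V_tensor mOmega Omega_lty N zeta tu.
rewrite -aE//; apply: (le_trans (ler_norm _)); apply: (le_trans (normr_cRe _)).
apply: (le_trans (aM _ _ V1 V2)).
have v1 : 0 <= V_norm Omega (tensor (trunc N xi) u) by exact: sqrtr_ge0.
have v2 : 0 <= V_norm Omega (tensor (trunc N zeta) u) by exact: sqrtr_ge0.
move: (V_norm Omega (tensor (trunc N xi) u)) (V_norm Omega (tensor (trunc N zeta) u))
  n1 n2 v1 v2 => p q n1 n2 p0 q0.
have pq : p * q <= (psum2 xi N + psum2 zeta N) * energy Omega u.
  by have := sqr_ge0 (p - q); have := mulr_ge0 p0 q0; rewrite sqrrD mulrDl sqrrN; lra.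
have K1 : M <= `|M| + 1 by rewrite (le_trans (ler_norm M))// lerDl.
rewrite -!mulrA; apply: (@le_trans _ _ ((`|M| + 1) * (p * q))).
  by rewrite ler_wpM2r// mulr_ge0.
by rewrite ler_wpM2l// addr_ge0.
Qed.

(** Insert cos (s x_0) eta and sin (s x_0) eta into the bound of the form on
    elementary tensors and add: the weighted Dirichlet integrals grow like
    s^2 times the weighted integral of eta^2, the right-hand side like
    s^2 times the integral of eta^2. Dividing by s^2 removes the derivatives, and
    since eta is an arbitrary cutoff function a pointwise inequality remains,
    for each pair of rational vectors off a null set; there are countably many
    such pairs. *)
Lemma bounded_of_form_continuous : ess_uniformly_bounded Omega C.
Proof.
have [c [mc Cc]] := mult_op_entries mC.
have ci := entry_integrable mc Cc.
have [K K0 HK] := form_tensor_le.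
pose q N s t x := cRe (sesqui_at c N (qvec s) (qvec t) x).
pose S N s t : R := K * (psum2 (qvec s) N + psum2 (qvec t) N).
have qi N s t : mu.-integrable Omega (EFin \o q N s t) by exact: sesqui_at_integrable.
have qle N s t eta : tame eta ->
    \int[mu]_(x in Omega) (q N s t x * eta x ^+ 2) <= S N s t * \int[mu]_(x in Omega) (eta x ^+ 2).
  move=> te; apply: (@quadratic_growth_le _ _
    (\sum_(k < d) \int[mu]_(x in Omega) (q N s t x * partial k eta x ^+ 2)) _
    (S N s t * energy Omega eta)) => z.
  have [a [b wab]] := wave_exists i0 z; have [ta tb _ _ _] := wab.
  rewrite -(weighted_gradient_wave mOmega (qi N s t) wab te).
  rewrite mulrCA -mulrDr -(energy_wave mOmega Omega_lty wab te) mulrDr.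
  apply: lerD.
  - by rewrite -(cRe_form_tensor mOmega Cc ci _ _ _ (tameM ta te)); exact: HK (tameM ta te).
  - by rewrite -(cRe_form_tensor mOmega Cc ci _ _ _ (tameM tb te)); exact: HK (tameM tb te).
have qae N s t : {ae mu, forall x, Omega x -> q N s t x <= S N s t}.
  (* S - q is integrable, so its sign is detected by the squares of cutoffs. *)
  have cSi : mu.-integrable Omega (EFin \o (cst (S N s t) : 'rV[R]_d -> R)).
    exact: (@bounded_Omega_integrable _ _ _ mOmega Omega_lty _ `|S N s t|).
  have ri : mu.-integrable Omega (EFin \o (fun x => S N s t - q N s t x)).
    by have := integrableB mOmega cSi (qi N s t); apply: eq_integrable.
  have := ae_ge0_of_cutoff mOmega ri; set H := (X in (X -> _) -> _) => Hae.
  suff G : {ae mu, forall x, Omega x -> 0 <= S N s t - q N s t x}.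
    by apply: filterS G => x + Ox => /(_ Ox); rewrite subr_ge0.
  apply: Hae => f [tf _]; have fi := tame_sqr_integrable mOmega Omega_lty tf.
  have [mf [B fB] _ _] := tf.
  have qfi : mu.-integrable Omega (EFin \o (fun x => q N s t x * f x ^+ 2)).
    apply: (@integrable_mul_bounded _ _ _ mOmega _ _ (B ^+ 2)) => //.
      by apply: measurable_funX; exact: measurable_funTS.
    by move=> x; rewrite normrX ler_pXn2r// nnegrE (le_trans _ (fB x)).
  have Sfi : mu.-integrable Omega (EFin \o (fun x => S N s t * f x ^+ 2)).
    by have := integrableZl mOmega (S N s t) fi; apply: eq_integrable.
  rewrite (@eq_Rintegral _ _ _ mu Omega (fun x => S N s t * f x ^+ 2 - q N s t x * f x ^+ 2)).
    by rewrite RintegralB// RintegralZl// subr_ge0; exact: qle.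
  by move=> x _; ring.
have {}qae : {ae mu, forall x, forall p : nat * seq (rat * rat) * seq (rat * rat), Omega x ->
    q p.1.1 p.1.2 p.2 x <= S p.1.1 p.1.2 p.2}.
  have /ae_foralln H : forall n : nat, {ae mu, forall x,
      forall p : nat * seq (rat * rat) * seq (rat * rat), unpickle n = Some p -> Omega x ->
      q p.1.1 p.1.2 p.2 x <= S p.1.1 p.1.2 p.2}.
    move=> n; case E : (unpickle n) => [p|]; last exact: aeW.
    by apply: filterS (qae p.1.1 p.1.2 p.2) => x H p' [<-] Ox; exact: H.
  by apply: filterS H => x H p; apply: (H (pickle p)); exact: pickleK.
exists (2 * K); first by rewrite mulr_ge0// ltW.
apply: filterS2 qae Cc => x H xc Ox; apply: ell2_opnorm_sesqui_le => // N u v.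
apply: sesqui_rat_dense => s t; have := H (N, s, t) Ox; rewrite /q /sesqui_at /=.
by have -> : (fun i j => c i j x) = ell2_entry (C x) by apply/funext => i; apply/funext => j; rewrite xc.
Qed.

End boundedness.

(** * The equivalence *)

Lemma form_continuous_dim0 (R : realType) (Omega : set 'rV[R]_0) (C : 'rV[R]_0 -> ell2_op R) :
  form_continuous Omega C.
Proof.
split; first by move=> psi _ _ [].
exists (fun _ _ => 0); split.
- by move=> c psi phi chi _ _ _; rewrite !mulr0 addr0.
- by exists 0 => psi phi _ _; rewrite normc0 !mul0r.
- by move=> psi phi _ _ _ _; rewrite /Defs.form /inner_Hd big_ord0.
Qed.

Lemma ess_uniformly_bounded_dim0 (R : realType) (Omega : set 'rV[R]_0)
    (C : 'rV[R]_0 -> ell2_op R) : ess_uniformly_bounded Omega C.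
Proof.
exists `|ell2_opnorm (C 0)| => //; apply: aeW => x _.
by rewrite (thinmx0 x); exact: ler_norm.
Qed.

Theorem proposition12 (R : realType) (d : nat) (Omega : set 'rV[R]_d)
    (C : 'rV[R]_d -> ell2_op R) :
  open Omega -> connected Omega -> Omega !=set0 ->
  (lebesgue_rV d Omega < +oo)%E ->
  componentwise_measurable Omega C ->
  form_continuous Omega C <-> ess_uniformly_bounded Omega C.
Proof.
(* Without coordinates there are no waves: the form vanishes, and the space is
   a single point. *)
case: d Omega C => [|d] Omega C.
  by move=> *; split => _; [exact: ess_uniformly_bounded_dim0|exact: form_continuous_dim0].
move=> oO _ _ Ooo mC; have mOmega := open_measurable_rV oO; split.
- exact: (bounded_of_form_continuous mOmega Ooo ord0 mC).
- by move=> [M M0 CM]; exact: (form_continuous_of_bounded mOmega mC M0 CM).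
Qed.
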